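(* Let $\pi_0$ be the bipartite state on $\mathbb{C}^3\otimes\mathbb{C}^3$ given by $$\pi_0=\frac17\left(\sum_{i,j=1}^3|ii\rangle\langle jj|+\sum_{i\neq j}Q_{ij}\,|ij\rangle\langle ij|\right),\qquad Q=\begin{pmatrix}1&0&1\\0&1&1\\1&1&1\end{pmatrix}.$$ Then $$2\,E_{c,\mathrm{PPT}}^{\mathrm{exact}}(\pi_0)\ \leq\ E_\kappa\big(\pi_0^{\otimes2}\big)\ <\ 2\,E_\kappa(\pi_0)\,.$$ In particular, $E_\kappa(\pi_0^{\otimes2})\approx1.001$ and $2E_\kappa(\pi_0)\approx1.029$ (values to three decimal places).
   Context: A state on $AB$ is a positive semi-definite unit-trace operator on $\mathcal{H}_A\otimes\mathcal{H}_B$ (finite-dimensional). $X\leq Y$ means $Y-X$ is positive semi-definite. $\Gamma$ is the partial transpose on the second party: the linear map with $(X_A\otimes Y_B)^\Gamma=X_A\otimes Y_B^{\intercal}$ (transpose in a fixed basis). $\rho^{\otimes n}$ is regarded as a bipartite state with parties $A^n$ and $B^n$. $E_\kappa(\rho):=\log_2\min\{\mathrm{Tr}\,S:\ -S\leq\rho^\Gamma\leq S,\ S^\Gamma\geq0\}$, over Hermitian operators $S$ on $\mathcal{H}_A\otimes\mathcal{H}_B$. A completely positive map $\Lambda$ from operators on $AB$ to operators on $A'B'$ is PPT if $\Gamma_{B'}\circ\Lambda\circ\Gamma_B$ is also completely positive; a PPT channel is a trace-preserving PPT map. With $\Phi_2=|\Phi_2\rangle\langle\Phi_2|$, $|\Phi_2\rangle=\frac{1}{\sqrt2}(|00\rangle+|11\rangle)$,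 the zero-error PPT entanglement cost is $$E_{c,\mathrm{PPT}}^{\mathrm{exact}}(\rho):=\inf\{R:\ \text{for all sufficiently large } n\in\mathbb{N}\ \exists\text{ a PPT channel }\Lambda_n\text{ with }\Lambda_n(\Phi_2^{\otimes\lfloor Rn\rfloor})=\rho^{\otimes n}\}.$$ *)

(* Defs.v *)
From HB Require Import structures.
From mathcomp Require Import all_boot all_order all_algebra.
From mathcomp Require Export spectral complex mxtens.
From mathcomp Require Import all_classical all_reals all_analysis.
From mathcomp Require Import ring lra.
Set Implicit Arguments.
Unset Strict Implicit.
Unset Printing Implicit Defensive.
Import Order.TTheory GRing.Theory Num.Theory.
Import numFieldTopology.Exports numFieldNormedType.Exports.
Local Open Scope ring_scope.
Local Open Scope classical_set_scope.
Local Open Scope complex_scope.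
Local Open Scope sesquilinear_scope.

(* An operator on H_A (x) H_B with dim H_A = a and dim H_B = b is a matrix
   of type 'M[R[i]]_(a * b); the basis vector |xy> has the index
   mxtens_index (x, y), so that the tensor product is *t of mxtens. *)

Section Operators.
Variable R : realType.
Local Notation C := R[i].

Definition psdmx n (X : 'M[C]_n) : Prop :=
  X \is hermsymmx /\ forall v : 'cV[C]_n, 0 <= (v ^t* *m X *m v) 0 0.

Definition loewner n (X Y : 'M[C]_n) : Prop := psdmx (Y - X).

Definition state n (X : 'M[C]_n) : Prop := psdmx X /\ \tr X = 1.

Definition ptrans a b (X : 'M[C]_(a * b)) : 'M[C]_(a * b) :=
  \matrix_(i, j)
    X (mxtens_index ((mxtens_unindex i).1, (mxtens_unindex j).2))
      (mxtens_index ((mxtens_unindex j).1, (mxtens_unindex i).2)).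

Lemma ptrans_tens a b (X : 'M[C]_a) (Y : 'M[C]_b) :
  ptrans (X *t Y) = X *t Y^T.
Proof. by apply/matrixP => i j; rewrite !mxE !mxtens_indexK. Qed.

Lemma ptrans_is_linear a b : linear (@ptrans a b).
Proof. by move=> k X Y; apply/matrixP => i j; rewrite !mxE. Qed.

(* On indices, ((A A') (B B')) |-> ((A B) (A' B')). *)
Definition regroup a b c d (i : 'I_((a * c) * (b * d))) :
    'I_((a * b) * (c * d)) :=
  let i1 := mxtens_unindex (mxtens_unindex i).1 in
  let i2 := mxtens_unindex (mxtens_unindex i).2 in
  mxtens_index (mxtens_index (i1.1, i2.1), mxtens_index (i1.2, i2.2)).

(* Tensor product of an operator on AB and one on A'B', as an operator on
   the bipartite system with parties AA' and BB'. *)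
Definition btens a b c d (X : 'M[C]_(a * b)) (Y : 'M[C]_(c * d)) :
    'M[C]_((a * c) * (b * d)) :=
  mxsub (@regroup a b c d) (@regroup a b c d) (X *t Y).

Lemma btens_tens a b c d (X : 'M[C]_a) (Y : 'M[C]_b)
    (Z : 'M[C]_c) (T : 'M[C]_d) :
  btens (X *t Y) (Z *t T) = (X *t Z) *t (Y *t T).
Proof.
by apply/matrixP => i j; rewrite !mxE !mxtens_indexK /= mulrACA.
Qed.

(* a ^ k.+2 is convertible to a * a ^ k.+1, but a ^ 1 is not convertible to
   a * a ^ 0; as for ntensmx, the recursion therefore starts at exponent 1. *)
Fixpoint btensX_rec a b (X : 'M[C]_(a * b)) k :
    'M[C]_(a ^ k.+1 * b ^ k.+1) :=
  if k is k'.+1 then btens X (btensX_rec X k') else X.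

Definition btensX a b (X : 'M[C]_(a * b)) n : 'M[C]_(a ^ n * b ^ n) :=
  if n is k.+1 return 'M[C]_(a ^ n * b ^ n) then btensX_rec X k else 1%:M.

Definition log2 (x : R) : R := ln x / ln 2.

Definition kappa_feasible a b (rho S : 'M[C]_(a * b)) : Prop :=
  [/\ S \is hermsymmx, loewner (- S) (ptrans rho), loewner (ptrans rho) S
    & loewner 0 (ptrans S)].

(* The infimum is attained for every Hermitian rho, see Ekappa_minE below. *)
Definition Ekappa a b (rho : 'M[C]_(a * b)) : R :=
  log2 (inf [set complex.Re (\tr S) | S in kappa_feasible rho]).

Definition ampliation k m n (L : 'M[C]_m -> 'M[C]_n) (X : 'M[C]_(k * m)) :
    'M[C]_(k * n) :=
  \matrix_(i, j)
    L (\matrix_(p, q) X (mxtens_index ((mxtens_unindex i).1, p))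
                        (mxtens_index ((mxtens_unindex j).1, q)))
      (mxtens_unindex i).2 (mxtens_unindex j).2.

Lemma ampliation_tens k m n (L : {linear 'M[C]_m -> 'M[C]_n})
    (X : 'M[C]_k) (Y : 'M[C]_m) :
  ampliation L (X *t Y) = X *t L Y.
Proof.
apply/matrixP => i j; rewrite !mxE.
set M := matrix_of_fun _ _.
suff -> : M = X (mxtens_unindex i).1 (mxtens_unindex j).1 *: Y.
  by rewrite linearZ mxE.
by apply/matrixP => p q; rewrite !mxE !mxtens_indexK.
Qed.

Definition completely_positive m n (L : 'M[C]_m -> 'M[C]_n) : Prop :=
  forall k (X : 'M[C]_(k * m)), psdmx X -> psdmx (ampliation L X).

Definition ppt_map a b c d (L : {linear 'M[C]_(a * b) -> 'M[C]_(c * d)}) :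
    Prop :=
  completely_positive L /\
  completely_positive (fun X => ptrans (L (ptrans X))).

Definition ppt_channel a b c d (L : {linear 'M[C]_(a * b) -> 'M[C]_(c * d)}) :
    Prop :=
  ppt_map L /\ forall X, \tr (L X) = \tr X.

Definition Phi2_ket : 'cV[C]_(2 * 2) :=
  (sqrtC 2)^-1 *: \sum_(i < 2) delta_mx (mxtens_index (i, i)) 0.

Definition Phi2 : 'M[C]_(2 * 2) := Phi2_ket *m Phi2_ket ^t*.

(* Since 0 <= r, Num.truncn (r * n%:R) is the floor of r * n. *)
Definition achievable_rate a b (rho : 'M[C]_(a * b)) : set R :=
  [set r | 0 <= r /\
     \forall n \near \oo,
       exists L : {linear 'M[C]_(2 ^ Num.truncn (r * n%:R) *
                                 2 ^ Num.truncn (r * n%:R)) ->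
                          'M[C]_(a ^ n * b ^ n)},
         ppt_channel L /\
         L (btensX Phi2 (Num.truncn (r * n%:R))) = btensX rho n].

Definition Ec_ppt_exact a b (rho : 'M[C]_(a * b)) : \bar R :=
  ereal_inf [set r%:E | r in achievable_rate rho].

Definition Qmx : 'M[C]_3 :=
  \matrix_(i, j) nth 0 (nth [::] [:: [:: 1; 0; 1];
                                     [:: 0; 1; 1];
                                     [:: 1; 1; 1]] i) j.

Definition pi0 : 'M[C]_(3 * 3) :=
  7%:R^-1 *:
    (\sum_(i < 3) \sum_(j < 3)
        delta_mx (mxtens_index (i, i)) (mxtens_index (j, j))
     + \sum_(i < 3) \sum_(j < 3 | j != i)
        Qmx i j *: delta_mx (mxtens_index (i, j)) (mxtens_index (i, j))).

End Operators.

Arguments Qmx : clear implicits.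
Arguments pi0 : clear implicits.
Arguments Phi2 : clear implicits.

(* In complex_scope, z^* would be the function conjc instead of conjC. *)
Local Close Scope complex_scope.

Section Facts.
Variable R : realType.
Local Notation C := (complex R).

Lemma qformE n (X : 'M[C]_n) (v : 'cV[C]_n) :
  (v ^t* *m X *m v) 0 0 = \sum_j \sum_i (v i 0)^* * X i j * v j 0.
Proof.
by rewrite mxE; apply: eq_bigr => j _; rewrite mxE mulr_suml;
  apply: eq_bigr => i _; rewrite !mxE.
Qed.

Lemma hermsymmxP n (X : 'M[C]_n) :
  X \is hermsymmx <-> forall i j, X i j = (X j i)^*.
Proof.
rewrite qualifE /= expr0 scale1r; split.
  by move/eqP => XE i j; rewrite {1}XE !mxE.
by move=> XE; apply/eqP/matrixP => i j; rewrite !mxE.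
Qed.

Lemma psdmxD n (X Y : 'M[C]_n) : psdmx X -> psdmx Y -> psdmx (X + Y).
Proof.
move=> [/hermsymmxP hX pX] [/hermsymmxP hY pY]; split.
  by apply/hermsymmxP => i j; rewrite !mxE hX hY rmorphD.
by move=> v; rewrite mulmxDr mulmxDl mxE addr_ge0.
Qed.

Lemma psdmx_diag n (X : 'M[C]_n) i : psdmx X -> 0 <= X i i.
Proof.
move=> [_ /(_ (delta_mx i 0))]; rewrite qformE (bigD1 i) //= (bigD1 i) //=.
rewrite big1 => [|j /negPf ji]; last by rewrite !mxE ji conjC0 !mul0r.
rewrite big1 => [|j /negPf ji].
  by rewrite !mxE !eqxx conjC1 mul1r mulr1 !addr0.
by apply: big1 => k _; rewrite !mxE ji mulr0.
Qed.

Lemma psdmx_off_alg (K : comNzRingType) (a b c d l m : K) :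
  a + l * b + (m * c + l * (m * d)) = a + d * (m * l) + (b * l + c * m).
Proof.
ring.
Qed.

Lemma psdmx_off n (X : 'M[C]_n) i j (l : C) : psdmx X ->
  0 <= X i i + X j j * (l^* * l) + (X i j * l + (X i j * l)^*).
Proof.
move=> [/hermsymmxP hX /(_ (delta_mx i 0 + l *: delta_mx j 0))].
have tE (k : 'I_n) : (delta_mx k 0 : 'cV[C]_n) ^t* = delta_mx 0 k.
  by apply/matrixP => p q; rewrite !mxE rmorph_nat andbC.
have -> : (delta_mx i 0 + l *: delta_mx j 0 : 'cV[C]_n) ^t*
    = delta_mx 0 i + l^* *: delta_mx 0 j.
  by rewrite !linearD /= map_mxD tE linearZ /= map_mxZ tE.
have e p q : ((delta_mx 0 p : 'rV[C]_n) *m X *m (delta_mx q 0 : 'cV[C]_n)) 0 0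
    = X p q.
  by rewrite -rowE -colE !mxE.
rewrite !mulmxDl !mulmxDr -!scalemxAr -!scalemxAl.
have eA p q : ((delta_mx 0 p : 'rV[C]_n) *m X *m (delta_mx q 0 : 'cV[C]_n)) =
   (X p q)%:M.
  by rewrite [LHS]mx11_scalar e.
have -> : (X i j * l)^* = X j i * l^* by rewrite (hX j i) rmorphM.
rewrite !eA => /le_trans; apply.
rewrite [X in X <= _]mxE ![in X in X <= _]mxE !mulr1n.
rewrite le_eqVlt; apply/orP; left; apply/eqP.
exact: psdmx_off_alg.
Qed.


Lemma Re_sum (I : Type) (r : seq I) (P : pred I) (F : I -> C) :
  complex.Re (\sum_(i <- r | P i) F i) = \sum_(i <- r | P i) complex.Re (F i).
Proof. by apply: (big_morph (@complex.Re R)) => // -[a b] [c d]. Qed.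

Lemma psdmx_entry n (X : 'M[C]_n) i j : psdmx X ->
  `|complex.Re (X i j)| <= complex.Re (\tr X) /\
  `|complex.Im (X i j)| <= complex.Re (\tr X).
Proof.
move=> pX.
have d k : 0 <= complex.Re (X k k) <= complex.Re (\tr X).
  have pd m : 0 <= complex.Re (X m m).
    by have := psdmx_diag m pX; rewrite lecE => /andP[].
  by rewrite pd /mxtrace Re_sum (bigD1 k) //= lerDl sumr_ge0.
have /andP[i0 i1] := d i; have /andP[j0 j1] := d j.
have o (l : C) : 0 <= complex.Re (X i i + X j j * (conjc l * l) +
     (X i j * l + conjc (X i j * l))).
  by have := psdmx_off i j l pX; rewrite lecE => /andP[].
have := o 1; have := o (-1); have := o (Complex 0 1); have := o (Complex 0 (-1)).
case: (X i i) i0 i1 => [a a'] /= i0 i1; case: (X j j) j0 j1 => [b b'] /= j0 j1.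
case: (X i j) => [x y] /= h1 h2 h3 h4.
by split; rewrite ler_norml; apply/andP; split; lra.
Qed.

Definition cvec n (x : 'rV[R]_(n * n + n * n)) : 'M[C]_n :=
  \matrix_(i, j) Complex (x 0 (lshift _ (mxvec_index i j)))
                         (x 0 (rshift _ (mxvec_index i j))).

Lemma cvec_surj n (X : 'M[C]_n) : exists x, cvec x = X.
Proof.
exists (row_mx (mxvec (map_mx (@complex.Re R) X)) (mxvec (map_mx (@complex.Im R) X))).
apply/matrixP => i j; rewrite mxE row_mxEl row_mxEr !mxvecE !mxE.
by case: (X i j).
Qed.

Lemma closed_ge0 n (A : 'rV[R]_n -> C) :
  continuous (fun x => complex.Re (A x)) ->
  continuous (fun x => complex.Im (A x)) -> closed [set x | 0 <= A x].
Proof.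
move=> cr ci.
have -> : [set x | 0 <= A x] = ((fun x => complex.Im (A x)) @^-1` [set y | y = 0])
    `&` ((fun x => complex.Re (A x)) @^-1` [set y | 0 <= y]).
  apply/seteqP; split => x /=; rewrite lecE /=.
    by move=> /andP[/eqP].
  by move=> [-> ->]; rewrite eqxx.
apply: closedI.
  by apply: preimage_closed; [move=> ? _; exact: ci|exact: closed_eq].
by apply: preimage_closed; [move=> ? _; exact: cr|exact: closed_ge].
Qed.


Definition ccont (T : topologicalType) (f : T -> C) :=
  continuous (fun x => complex.Re (f x)) /\
  continuous (fun x => complex.Im (f x)).

Section Ccont.
Variable T : topologicalType.
Implicit Types f g : T -> C.

Lemma ccont_cst (c : C) : ccont (fun _ : T => c).
Proof. by split=> x; exact: cvg_cst. Qed.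

Lemma ccontD f g : ccont f -> ccont g -> ccont (fun x => f x + g x).
Proof.
move=> [f1 f2] [g1 g2]; split=> x.
  rewrite (_ : (fun _ => _) = (fun x => complex.Re (f x) + complex.Re (g x))).
    exact: (cvgD (f1 x) (g1 x)).
  by apply/funext => y; case: (f y) => ? ?; case: (g y).
rewrite (_ : (fun _ => _) = (fun x => complex.Im (f x) + complex.Im (g x))).
  exact: (cvgD (f2 x) (g2 x)).
by apply/funext => y; case: (f y) => ? ?; case: (g y).
Qed.

Lemma ccontM f g : ccont f -> ccont g -> ccont (fun x => f x * g x).
Proof.
move=> [f1 f2] [g1 g2]; split=> x.
  rewrite (_ : (fun _ => _) = (fun x => complex.Re (f x) * complex.Re (g x) -
     complex.Im (f x) * complex.Im (g x))).
    exact: (cvgB (cvgM (f1 x) (g1 x)) (cvgM (f2 x) (g2 x))).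
  by apply/funext => y; case: (f y) => ? ?; case: (g y).
rewrite (_ : (fun _ => _) = (fun x => complex.Re (f x) * complex.Im (g x) +
     complex.Im (f x) * complex.Re (g x))).
  exact: (cvgD (cvgM (f1 x) (g2 x)) (cvgM (f2 x) (g1 x))).
by apply/funext => y; case: (f y) => ? ?; case: (g y).
Qed.

Lemma ccont_conj f : ccont f -> ccont (fun x => (f x)^*).
Proof.
move=> [f1 f2]; split=> x.
  rewrite (_ : (fun _ => _) = (fun x => complex.Re (f x))); first exact: f1.
  by apply/funext => y; case: (f y).
rewrite (_ : (fun _ => _) = (fun x => - complex.Im (f x))).
  exact: (cvgN (f2 x)).
by apply/funext => y; case: (f y).
Qed.

Lemma ccont_sum (I : Type) (r : seq I) (P : pred I) (F : I -> T -> C) :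
  (forall i, ccont (F i)) -> ccont (fun x => \sum_(i <- r | P i) F i x).
Proof.
move=> cF; elim: r => [|i r IH].
  by rewrite (_ : (fun _ => _) = (fun=> 0));
    [exact: ccont_cst | apply/funext => x; rewrite big_nil].
rewrite (_ : (fun _ => _) = (fun x => (if P i then F i x else 0) +
    \sum_(i <- r | P i) F i x)).
  by apply: ccontD => //; case: (P i) => //; exact: ccont_cst.
by apply/funext => x; rewrite big_cons; case: ifP => // _; rewrite add0r.
Qed.
End Ccont.

Lemma closed_psdmx n m (A : 'rV[R]_(n * n + n * n) -> 'M[C]_m) :
  (forall i j, ccont (fun x => A x i j)) -> closed [set x | psdmx (A x)].
Proof.
move=> cA.
have -> : [set x | psdmx (A x)] =
    (\bigcap_(v in [set: 'cV[C]_m]) [set x | 0 <= (v ^t* *m A x *m v) 0 0])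
    `&` (\bigcap_(p in [set: 'I_m * 'I_m])
          ([set x | 0 <= A x p.1 p.2 - (A x p.2 p.1)^*]
           `&` [set x | 0 <= (A x p.2 p.1)^* - A x p.1 p.2])).
  apply/seteqP; split => x /=.
    move=> [/hermsymmxP hx px]; split; first by move=> v _; exact: px.
    by move=> [i j] _ /=; rewrite -hx subrr.
  move=> [px hx]; split; last by move=> v; exact: px.
  apply/hermsymmxP => i j; have [/= h1 h2] := hx (i, j) Logic.I.
  by apply/eqP; rewrite eq_le -subr_ge0 h2 -subr_ge0 h1.
apply: closedI.
  apply: closed_bigI => v _.
  have [] // : ccont (fun x => (v ^t* *m A x *m v) 0 0); last exact: closed_ge0.
  rewrite (_ : (fun _ => _) = fun x =>
      \sum_j \sum_i (v i 0)^* * A x i j * v j 0).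
    apply: ccont_sum => j; apply: ccont_sum => i.
    apply: (@ccontM _ (fun x => (v i 0)^* * A x i j) (fun _ => v j 0)).
      by apply: (@ccontM _ (fun _ => (v i 0)^*)) => //; exact: ccont_cst.
    exact: ccont_cst.
  by apply/funext => x; rewrite qformE.
apply: closed_bigI => p _.
have cN f : ccont f -> ccont (fun x : 'rV[R]_(n * n + n * n) => - f x).
  move=> cf; rewrite (_ : (fun _ => _) = (fun x => -1 * f x)).
    by apply: (@ccontM _ (fun _ => -1)) => //; exact: ccont_cst.
  by apply/funext => x; rewrite mulN1r.
apply: closedI.
  have [] // : ccont (fun x => A x p.1 p.2 - (A x p.2 p.1)^*);
    last exact: closed_ge0.
  apply: (@ccontD _ (fun x => A x p.1 p.2)) => //.
  by apply: cN; apply: ccont_conj; exact: cA.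
have [] // : ccont (fun x => (A x p.2 p.1)^* - A x p.1 p.2);
  last exact: closed_ge0.
apply: (@ccontD _ (fun x => (A x p.2 p.1)^*)).
  by apply: ccont_conj; exact: cA.
exact: cN.
Qed.

Lemma cvec_ccont n i j : ccont (fun x => @cvec n x i j).
Proof.
split=> x.
  rewrite (_ : (fun _ => _) =
      (fun x : 'rV[R]_(n * n + n * n) => x 0 (lshift _ (mxvec_index i j)))).
    exact: coord_continuous.
  by apply/funext => y; rewrite mxE.
rewrite (_ : (fun _ => _) =
    (fun x : 'rV[R]_(n * n + n * n) => x 0 (rshift _ (mxvec_index i j)))).
  exact: coord_continuous.
by apply/funext => y; rewrite mxE.
Qed.

Lemma hermsymmx_dominated n (H : 'M[C]_n) : H \is hermsymmx ->
  exists c : C, [/\ 0 <= c, psdmx (c%:M - H) & psdmx (c%:M + H)].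
Proof.
move=> /hermsymmxP hH; pose c := \sum_j \sum_i `|H i j|.
have c0 : 0 <= c by rewrite sumr_ge0 // => j _; rewrite sumr_ge0.
have cc : c^* = c by apply/CrealP; exact: ger0_real.
have z_real (v : 'cV[C]_n) : (v ^t* *m H *m v) 0 0 \is Num.real.
  apply/CrealP; rewrite qformE rmorph_sum /= exchange_big /=.
  apply: eq_bigr => j _.
  rewrite rmorph_sum; apply: eq_bigr => i _.
  by rewrite !rmorphM /= conjCK -hH mulrC mulrA mulrAC.
have z_le (v : 'cV[C]_n) : `|(v ^t* *m H *m v) 0 0| <= (v ^t* *m c%:M *m v) 0 0.
  pose s : C := \sum_k `|v k 0| ^+ 2.
  have -> : (v ^t* *m c%:M *m v) 0 0 = c * s.
    rewrite mul_mx_scalar -scalemxAl !mxE; congr (_ * _).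
    by apply: eq_bigr => k _; rewrite !mxE normCK mulrC.
  rewrite qformE (le_trans (ler_norm_sum _ _ _)) // mulr_suml ler_sum // => j _.
  rewrite (le_trans (ler_norm_sum _ _ _)) // mulr_suml ler_sum // => i _.
  rewrite !normrM norm_conjC mulrAC mulrC ler_wpM2l //.
  have vs k : `|v k 0| ^+ 2 <= s.
    by rewrite /s (bigD1 k) //= lerDl sumr_ge0 // => l _; rewrite exprn_ge0.
  have [le_ij|/ltW le_ji] := real_leP (normr_real (v i 0)) (normr_real (v j 0)).
    by apply: le_trans (vs j); rewrite expr2 ler_wpM2r.
  by apply: le_trans (vs i); rewrite expr2 ler_wpM2l.
exists c; split; [exact: c0 | split | split].
- by apply/hermsymmxP => i j; rewrite !mxE (hH i j) rmorphB rmorphMn /= cc eq_sym.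
- move=> v; rewrite mulmxBr mulmxBl [X in 0 <= X]mxE [X in _ + X]mxE subr_ge0.
  by apply: le_trans (z_le v); exact: real_ler_norm.
- by apply/hermsymmxP => i j; rewrite !mxE (hH i j) rmorphD rmorphMn /= cc eq_sym.
- move=> v; rewrite mulmxDr mulmxDl [X in 0 <= X]mxE -lerBlDr sub0r.
  by apply: le_trans (z_le v); rewrite -normrN real_ler_norm // realN.
Qed.

Lemma psdmxZ n (X : 'M[C]_n) (c : C) : 0 <= c -> psdmx X -> psdmx (c *: X).
Proof.
move=> c0 [/hermsymmxP hX pX]; split.
  have cc : c^* = c by apply/CrealP; exact: ger0_real.
  by apply/hermsymmxP => i j; rewrite !mxE (hX i j) rmorphM /= cc.
by move=> v; rewrite -scalemxAr -scalemxAl mxE mulr_ge0.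
Qed.

Lemma psdmx_half n (X : 'M[C]_n) : psdmx (X + X) -> psdmx X.
Proof.
move=> pX; have -> : X = 2%:R^-1 *: (X + X).
  by rewrite -mulr2n -(scaler_nat 2 X) scalerA mulVf ?pnatr_eq0 // scale1r.
by apply: psdmxZ pX; rewrite invr_ge0.
Qed.

Lemma kappa_feasible_psd a b (rho S : 'M[C]_(a * b)) :
  kappa_feasible rho S -> psdmx S.
Proof.
move=> [_ h1 h2 _]; apply: psdmx_half.
by have := psdmxD h1 h2; rewrite opprK addrC addrA subrK.
Qed.

Lemma ptrans_herm a b (X : 'M[C]_(a * b)) :
  X \is hermsymmx -> ptrans X \is hermsymmx.
Proof.
by move=> /hermsymmxP hX; apply/hermsymmxP => i j; rewrite !mxE hX.
Qed.

Lemma ptrans_scalar a b (c : C) : ptrans (c%:M : 'M[C]_(a * b)) = c%:M.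
Proof.
apply/matrixP => i j.
case: (mxtens_indexP i) => i1 i2; case: (mxtens_indexP j) => j1 j2.
rewrite !mxE !mxtens_indexK !(can_eq (@mxtens_indexK a b)) !xpair_eqE.
by rewrite [in RHS](eq_sym i2).
Qed.

Lemma kappa_feasible_min a b (rho : 'M[C]_(a * b)) : rho \is hermsymmx ->
  exists2 S, kappa_feasible rho S &
    forall T, kappa_feasible rho T -> complex.Re (\tr S) <= complex.Re (\tr T).
Proof.
move=> hrho; have [c [c0 cm cp]] := hermsymmx_dominated (ptrans_herm hrho).
have sc_psd : psdmx (c%:M : 'M[C]_(a * b)).
  by apply: psdmx_half; have := psdmxD cm cp; rewrite addrACA addNr addr0.
have fc : kappa_feasible rho c%:M.
  split; first exact: sc_psd.1.
  - by rewrite /loewner opprK [X in psdmx X]addrC; exact: cp.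
  - exact: cm.
  - by rewrite /loewner ptrans_scalar subr0.
pose t := complex.Re (\tr (c%:M : 'M[C]_(a * b))).
pose A := [set x | kappa_feasible rho (cvec x)] `&`
  [set x | complex.Re (\tr (cvec x)) <= t].
have tr_cont : continuous (fun x => complex.Re (\tr (@cvec (a * b) x))).
  by have [] : ccont (fun x => \tr (@cvec (a * b) x))
    by apply: ccont_sum => i; exact: cvec_ccont.
have cD (X : 'M[C]_(a * b)) i j : ccont (fun x => (cvec x + X) i j).
  rewrite (_ : (fun _ => _) = (fun x => cvec x i j + X i j)).
    apply: (@ccontD _ (fun x => cvec x i j)); first exact: cvec_ccont.
    exact: ccont_cst.
  by apply/funext => x; rewrite mxE.
have clA : closed A.
  apply: closedI; last first.
      have cl := @preimage_closed _ _ (fun x => complex.Re (\tr (@cvec (a * b) x)))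
      [set y | y <= t].
    by apply: cl; [move=> ? _; exact: tr_cont|exact: closed_le].
  have -> : [set x | kappa_feasible rho (cvec x)] =
      [set x | psdmx (@cvec (a * b) x + 0)] `&`
      ([set x | psdmx (cvec x + ptrans rho)] `&`
      ([set x | psdmx (cvec x + - ptrans rho)] `&`
       [set x | psdmx (ptrans (@cvec (a * b) x))])).
    apply/seteqP; split => x /=.
      move=> fx; have h1 := kappa_feasible_psd fx.
      case: fx => _; rewrite /loewner opprK subr0 => h2 h3 h4.
      rewrite addr0 [cvec x + ptrans rho]addrC.
      exact: (conj h1 (conj h2 (conj h3 h4))).
    move=> [h1 [h2 [h3 h4]]]; rewrite addr0 in h1; split.
    - exact: h1.1.
    - by rewrite /loewner opprK [X in psdmx X]addrC; exact: h2.
    - exact: h3.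
    - by rewrite /loewner subr0; exact: h4.
  do 3!(apply: closedI; first by apply: closed_psdmx => i j; exact: cD).
  apply: closed_psdmx => i j.
  rewrite (_ : (fun _ => _) = (fun x => cvec x
    (mxtens_index ((mxtens_unindex i).1, (mxtens_unindex j).2))
    (mxtens_index ((mxtens_unindex j).1, (mxtens_unindex i).2)))).
    exact: cvec_ccont.
  by apply/funext => x; rewrite mxE.
have bdA : bounded_set A.
  exists t; split; first exact: num_real.
  move=> M tM x [fx /= xt]; have px := kappa_feasible_psd fx.
  have M0 : 0 <= M.
    apply/ltW/(le_lt_trans _ tM).
    rewrite /t /mxtrace Re_sum sumr_ge0 // => i _.
    by have := psdmx_diag i sc_psd; rewrite lecE => /andP[].
  rewrite /= /Num.norm /= mx_normrE; apply: bigmax_le => // -[i k] _ /=.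
  rewrite ord1; case: (split_ordP k) => l ->.
    case/mxvec_indexP: l => p q.
    have [+ _] := psdmx_entry p q px; rewrite mxE /= => /le_trans; apply.
    exact: le_trans xt (ltW tM).
  case/mxvec_indexP: l => p q.
  have [_] := psdmx_entry p q px; rewrite mxE /= => /le_trans; apply.
  exact: le_trans xt (ltW tM).
have [x0 x0E] := cvec_surj (c%:M : 'M[C]_(a * b)).
have A0 : A !=set0 by exists x0; split; rewrite /= x0E.
have [x] := EVT_min_rV A0 (bounded_closed_compact bdA clA)
  (continuous_subspaceT tr_cont).
rewrite inE => -[fx xt] xmin; exists (cvec x) => // T fT.
have [y yT] := cvec_surj T; case: (lerP (complex.Re (\tr T)) t) => [Tt|/ltW].
  by rewrite -yT; apply: xmin; rewrite inE; split; rewrite /= yT.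
exact: le_trans.
Qed.

Lemma Ekappa_minE a b (rho : 'M[C]_(a * b)) : rho \is hermsymmx ->
  exists S, [/\ kappa_feasible rho S,
    forall T, kappa_feasible rho T ->
      complex.Re (\tr S) <= complex.Re (\tr T)
    & Ekappa rho = log2 (complex.Re (\tr S))].
Proof.
move=> /kappa_feasible_min[S fS minS]; exists S; split=> //; congr log2.
apply/eqP; rewrite eq_le; apply/andP; split.
  apply: ge_inf; last by exists S.
  by exists (complex.Re (\tr S)) => _ [T fT <-]; exact: minS.
by apply: lb_le_inf; [exists (complex.Re (\tr S)), S|
  move=> _ [T fT <-]; exact: minS].
Qed.

Lemma psdmx_rank1 n (u : 'cV[C]_n) : psdmx (u *m u ^t*).
Proof.
split.
  apply/hermsymmxP => i j; rewrite !mxE !big_ord1 !mxE rmorphM /= conjCK.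
  by rewrite mulrC.
move=> v; rewrite mulmxA -mulmxA mxE big_ord1.
have -> : (v ^t* *m u) 0 0 = ((u ^t* *m v) 0 0)^*.
  rewrite !mxE rmorph_sum; apply: eq_bigr => k _.
  by rewrite !mxE rmorphM /= conjCK mulrC.
by rewrite mulrC mul_conjC_ge0.
Qed.

Lemma psdmx_sum n (I : Type) (r : seq I) (P : pred I) (F : I -> 'M[C]_n) :
  (forall i, P i -> psdmx (F i)) -> psdmx (\sum_(i <- r | P i) F i).
Proof.
move=> pF; apply: (big_ind (@psdmx R n)); [|exact: psdmxD|exact: pF].
split; first by apply/hermsymmxP => i j; rewrite !mxE conjC0.
by move=> v; rewrite mulmx0 mul0mx mxE.
Qed.

Lemma delta_trCE n (k : 'I_n) : (delta_mx k 0 : 'cV[C]_n) ^t* = delta_mx 0 k.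
Proof. by apply/matrixP => p q; rewrite !mxE rmorph_nat andbC. Qed.

Lemma mxtrace_delta n (i j : 'I_n) : \tr (delta_mx i j : 'M[C]_n) = (i == j)%:R.
Proof.
rewrite /mxtrace (bigD1 i) //= big1 => [|k /negPf ki]; rewrite mxE.
  by rewrite eqxx addr0.
by rewrite ki.
Qed.

Lemma pi0_state : state (pi0 R).
Proof.
split.
  apply: psdmxZ; first by rewrite invr_ge0.
  apply: psdmxD.
    rewrite (_ : \sum_(i < 3) _ =
      (\sum_(i < 3) delta_mx (mxtens_index (i, i)) 0 : 'cV[C]_(3 * 3)) *m
      (\sum_(i < 3) delta_mx (mxtens_index (i, i)) 0 : 'cV[C]_(3 * 3)) ^t*).
      exact: psdmx_rank1.
    rewrite raddf_sum /= map_mx_sum mulmx_suml; apply: eq_bigr => i _.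
    rewrite mulmx_sumr; apply: eq_bigr => j _.
    by rewrite delta_trCE mul_delta_mx.
  apply: psdmx_sum => i _; apply: psdmx_sum => j _; apply: psdmxZ.
    by rewrite mxE; case: i => -[|[|[|//]]] ?; case: j => -[|[|[|//]]] ? /=.
  by rewrite -(mul_delta_mx (0 : 'I_1)) -delta_trCE; exact: psdmx_rank1.
rewrite /pi0 linearZ linearD /= !linear_sum /=.
rewrite [X in _ * (X + _)](_ : _ = 3%:R); last first.
  transitivity (\sum_(i < 3) (1 : C)); last by rewrite sumr_const card_ord.
  apply: eq_bigr => i _.
  rewrite linear_sum /= (bigD1 i) //= mxtrace_delta eqxx big1 ?addr0 //.
  move=> j ji; rewrite mxtrace_delta (can_eq (@mxtens_indexK 3 3)) xpair_eqE.
  by rewrite eq_sym (negPf ji).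
rewrite [X in _ * (_ + X)](_ : _ = 4%:R); last first.
  under eq_bigr => i _.
    rewrite linear_sum /=.
    under eq_bigr => j _ do rewrite linearZ /= mxtrace_delta eqxx mulr1 mxE.
    rewrite big_mkcond /=; over.
  by rewrite !big_ord_recl !big_ord0 /= !add0r !addr0 -[RHS]/(1 + (1 + (1 + 1))) !addrA.
by rewrite -natrD mulVf ?pnatr_eq0.
Qed.

End Facts.

(* Main.v *)
Require Import Defs.
From HB Require Import structures.
From mathcomp Require Import all_boot all_order all_algebra.
From mathcomp Require Import all_classical all_reals all_analysis.
From mathcomp Require Import ring lra.

(** For the first inequality, measure {Phi, 1 - Phi} on Phi = Phi_2^{(x) m},
    prepare rho^{(x) n} on success and S^Gamma / Tr S on failure. The partial
    transpose of Phi is F / 2^m with F the swap, so this channel is PPT as soon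
    as S is feasible for rho^{(x) n} and 1 + Tr S <= 2^m. Feasible points
    multiply under tensor products, so powers of an optimal S for two copies
    achieve every rate above E_kappa(rho^{(x) 2}) / 2.

    The values of E_kappa come from semidefinite duality, with everything
    invariant under local diagonal unitaries: on such operators Gamma exchanges
    two families whose positivity is a condition on 3 x 3 matrices. One copy
    has optimum exactly 10 / 7. For two copies, an explicit feasible S whose
    partial transpose is a sum of products of positive operators gives
    49 Tr S <= 98.1, while a dual point, which uses two entangled vectors and a
    term that is not invariant under flipping one copy, gives
    49 Tr S >= 98.06; note 100 / 49 = (10 / 7)^2. *)

Set Implicit Arguments.
Unset Strict Implicit.
Unset Printing Implicit Defensive.
Import Order.TTheory GRing.Theory Num.Theory.
Local Open Scope ring_scope.
Local Open Scope sesquilinear_scope.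

(** * Positive operators and bipartite tensor products *)

(** On one copy the constraint -S <= pi_0^Gamma <= S alone would cost Tr |pi_0^Gamma| = 9/7. The
    extra 1/7 is the price of S^Gamma >= 0: the 3 x 3 matrix governing the partial transpose of 7
    |pi_0^Gamma| is Q itself, and det Q = -1. Two copies recover part of this price. With u = |11> +
    |22> and w = |33>, the feasible point mixes 5u + 8w on both copies with 5u - 8w on both copies,
    so the relative sign is shared by the copies; terms odd in that sign shrink while those that are
    odd in each copy keep their full weight.

    Strictness alone needs only a feasible point with 49 Tr S < 100. The three decimals confine 49
    Tr S to about (98.034, 98.102), and this fixes the accuracy demanded of both certificates. They
    stay finite rational computations because pi_0 is also symmetric under exchanging the levels 1
    and 2, which leaves seven real coordinates per copy. *)

Section PositiveOperators.
Variable R : realType.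
Local Notation C := (complex R).

Lemma trmxC_mul m n p (A : 'M[C]_(m, n)) (B : 'M[C]_(n, p)) :
  (A *m B) ^t* = B ^t* *m A ^t*.
Proof. by rewrite trmx_mul map_mxM. Qed.

Lemma trmxC_tens m n p q (A : 'M[C]_(m, n)) (B : 'M[C]_(p, q)) :
  (A *t B) ^t* = A ^t* *t B ^t*.
Proof. by rewrite trmx_tens map_mxT. Qed.

Lemma hermsymmxE n (X : 'M[C]_n) : (X \is hermsymmx) = (X == X ^t*).
Proof. by rewrite qualifE /= expr0 scale1r. Qed.

Lemma psdmx_conj m n (M : 'M[C]_(m, n)) (X : 'M[C]_n) :
  psdmx X -> psdmx (M *m X *m M ^t*).
Proof.
move=> [hX pX]; split.
  move: hX; rewrite !hermsymmxE => /eqP hX.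
  by rewrite !trmxC_mul trmxCK -hX mulmxA.
move=> v; have := pX (M ^t* *m v).
by rewrite trmxC_mul trmxCK !mulmxA.
Qed.

Lemma psdmx1 n : psdmx (1%:M : 'M[C]_n).
Proof.
split=> [|v]; first exact: hermitian1mx_subproof.
by rewrite mulmx1 mxE sumr_ge0 // => i _; rewrite !mxE mulrC mul_conjC_ge0.
Qed.

Lemma psdmx_gram m n (Y : 'M[C]_(m, n)) : psdmx (Y *m Y ^t*).
Proof. by have := psdmx_conj Y (psdmx1 n); rewrite mulmx1. Qed.

Lemma psdmx0 n : psdmx (0 : 'M[C]_n).
Proof. by have := psdmx_gram (0 : 'M[C]_n); rewrite mul0mx. Qed.

Lemma diag_gram m n (V : 'M[C]_(m, n)) (D : 'rV[C]_n) :
  (forall i, 0 <= D 0 i) -> exists Y : 'M[C]_(m, n),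
  V *m diag_mx D *m V ^t* = Y *m Y ^t*.
Proof.
move=> D0; pose E : 'rV[C]_n := \row_i sqrtC (D 0 i).
have EE : diag_mx D = diag_mx E *m (diag_mx E) ^t*.
  have -> : (diag_mx E) ^t* = diag_mx E.
    apply/matrixP => i j; rewrite !mxE eq_sym; case: eqP => [->|_].
      by rewrite !mulr1n geC0_conj // sqrtC_ge0.
    by rewrite !mulr0n conjC0.
  rewrite mulmx_diag; congr diag_mx.
  by apply/rowP => i; rewrite !mxE -expr2 sqrtCK.
by exists (V *m diag_mx E); rewrite trmxC_mul !mulmxA EE mulmxA.
Qed.

(** By the spectral theorem. With Gram factors, stability of positivity under tensor products,
    submatrices and the trace pairing becomes algebra on the factors. *)
Lemma psdmx_gramP n (X : 'M[C]_n) :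
  psdmx X -> exists Y : 'M[C]_n, X = Y *m Y ^t*.
Proof.
move=> pX; have [hX _] := pX.
have := hermitian_normalmx hX => /orthomx_spectralP.
have := spectral_unitarymx X.
move: (spectralmx X) (spectral_diag X) => U D uU.
rewrite (invmx_unitary uU) => XE.
have UU : U *m U ^t* = 1%:M by apply/unitarymxP.
have DE : diag_mx D = U *m X *m U ^t*.
  by rewrite XE !mulmxA UU mul1mx -mulmxA UU mulmx1.
have D0 i : 0 <= D 0 i.
  by have := psdmx_diag i (psdmx_conj U pX); rewrite -DE mxE eqxx mulr1n.
by have [Y YE] := diag_gram (U ^t*) D0; exists Y; rewrite -YE trmxCK.
Qed.

Lemma psdmx_tens m n (X : 'M[C]_m) (Y : 'M[C]_n) :
  psdmx X -> psdmx Y -> psdmx (X *t Y).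
Proof.
move=> /psdmx_gramP[A ->] /psdmx_gramP[B ->].
by rewrite -tensmx_mul -trmxC_tens; exact: psdmx_gram.
Qed.

Lemma psdmx_mxsub m n (f : 'I_m -> 'I_n) (X : 'M[C]_n) :
  psdmx X -> psdmx (mxsub f f X).
Proof.
move=> /psdmx_gramP[A ->].
have -> : mxsub f f (A *m A ^t*) = rowsub f A *m (rowsub f A) ^t*.
  by apply/matrixP => i j; rewrite !mxE; apply: eq_bigr => k _; rewrite !mxE.
exact: psdmx_gram.
Qed.

Lemma mxtrace_psd_mul n (X Y : 'M[C]_n) :
  psdmx X -> psdmx Y -> 0 <= \tr (X *m Y).
Proof.
move=> /psdmx_gramP[A ->] pY; rewrite -mulmxA mxtrace_mulC.
have := psdmx_conj (A ^t*) pY; rewrite trmxCK => pZ.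
by rewrite sumr_ge0 // => i _; exact: psdmx_diag.
Qed.

Lemma psdmx_trace n (X : 'M[C]_n) : psdmx X -> 0 <= \tr X.
Proof. by move=> pX; rewrite sumr_ge0 // => i _; exact: psdmx_diag. Qed.

Lemma psdmxN_sandwich n (X S : 'M[C]_n) :
  loewner (- S) X /\ loewner X S <-> psdmx (S + X) /\ psdmx (S - X).
Proof. by rewrite /loewner opprK addrC. Qed.

Lemma psdmx_diff_le n (X S T : 'M[C]_n) :
  psdmx (S + X) -> psdmx (T - S) -> psdmx (T + X).
Proof. by move=> pSX pTS; have := psdmxD pTS pSX; rewrite addrA subrK. Qed.
End PositiveOperators.

(** * The bipartite tensor product and its compatibility with product, trace, adjoint and partial
    transpose *)

Section BipartiteTensor.
Variable R : realType.
Local Notation C := (complex R).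

Definition ungroup a b c d (i : 'I_((a * b) * (c * d))) :
    'I_((a * c) * (b * d)) :=
  let i1 := mxtens_unindex (mxtens_unindex i).1 in
  let i2 := mxtens_unindex (mxtens_unindex i).2 in
  mxtens_index (mxtens_index (i1.1, i2.1), mxtens_index (i1.2, i2.2)).

Lemma ungroupK a b c d : cancel (@ungroup a b c d) (@regroup a b c d).
Proof.
move=> i; case: (mxtens_indexP i) => j k.
case: (mxtens_indexP j) => ? ?; case: (mxtens_indexP k) => ? ?.
by rewrite /regroup /ungroup !mxtens_indexK.
Qed.

Lemma regroupK a b c d : cancel (@regroup a b c d) (@ungroup a b c d).
Proof.
move=> i; case: (mxtens_indexP i) => j k.
case: (mxtens_indexP j) => ? ?; case: (mxtens_indexP k) => ? ?.
by rewrite /regroup /ungroup !mxtens_indexK.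
Qed.

Section Dimensions.
Variables a b c d : nat.
Implicit Types (X : 'M[C]_(a * b)) (Y : 'M[C]_(c * d)).

Lemma btensE X Y i1 i2 i3 i4 j1 j2 j3 j4 :
  btens X Y
    (mxtens_index (mxtens_index (i1, i3), mxtens_index (i2, i4)))
    (mxtens_index (mxtens_index (j1, j3), mxtens_index (j2, j4))) =
  X (mxtens_index (i1, i2)) (mxtens_index (j1, j2)) *
  Y (mxtens_index (i3, i4)) (mxtens_index (j3, j4)).
Proof. by rewrite !mxE !mxtens_indexK. Qed.

Lemma btensDl X X' Y : btens (X + X') Y = btens X Y + btens X' Y.
Proof. by apply/matrixP => i j; rewrite !mxE mulrDl. Qed.

Lemma btensDr X Y Y' : btens X (Y + Y') = btens X Y + btens X Y'.
Proof. by apply/matrixP => i j; rewrite !mxE mulrDr. Qed.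

Lemma btensZl k X Y : btens (k *: X) Y = k *: btens X Y.
Proof. by apply/matrixP => i j; rewrite !mxE mulrA. Qed.

Lemma btensZr k X Y : btens X (k *: Y) = k *: btens X Y.
Proof. by apply/matrixP => i j; rewrite !mxE mulrCA. Qed.

Lemma btensNl X Y : btens (- X) Y = - btens X Y.
Proof. by rewrite -scaleN1r btensZl scaleN1r. Qed.

Lemma btensNr X Y : btens X (- Y) = - btens X Y.
Proof. by rewrite -scaleN1r btensZr scaleN1r. Qed.

Lemma btens_suml (I : Type) (r : seq I) (F : I -> 'M[C]_(a * b)) Y :
  btens (\sum_(i <- r) F i) Y = \sum_(i <- r) btens (F i) Y.
Proof.
apply: (big_morph (fun X => btens X Y)) => [X1 X2|]; first exact: btensDl.
by rewrite -(scale0r (0 : 'M[C]_(a * b))) btensZl scale0r.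
Qed.

Lemma btens_sumr (I : Type) (r : seq I) X (F : I -> 'M[C]_(c * d)) :
  btens X (\sum_(i <- r) F i) = \sum_(i <- r) btens X (F i).
Proof.
apply: (big_morph (btens X)) => [Y1 Y2|]; first exact: btensDr.
by rewrite -(scale0r (0 : 'M[C]_(c * d))) btensZr scale0r.
Qed.

Lemma btensM X X' Y Y' : btens X Y *m btens X' Y' = btens (X *m X') (Y *m Y').
Proof.
rewrite /btens -tensmx_mul; apply/matrixP => i j; rewrite !mxE.
rewrite (reindex (@ungroup a b c d)) /=; last first.
  by exists (@regroup a b c d) => k _; rewrite ?ungroupK ?regroupK.
by apply: eq_bigr => k _; rewrite [LHS]mulrC !mxE ungroupK mulrC.
Qed.

Lemma mxtrace_btens X Y : \tr (btens X Y) = \tr X * \tr Y.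
Proof.
rewrite /mxtrace mulr_sum [RHS](reindex (@regroup a b c d)) /=; last first.
  by exists (@ungroup a b c d) => k _; rewrite ?ungroupK ?regroupK.
by apply: eq_bigr => k _; rewrite !mxE.
Qed.

Lemma btens_trmxC X Y : (btens X Y) ^t* = btens (X ^t*) (Y ^t*).
Proof. by apply/matrixP => i j; rewrite !mxE rmorphM. Qed.

Lemma btens_scalar (k l : C) :
  btens (k%:M : 'M[C]_(a * b)) (l%:M : 'M[C]_(c * d)) = (k * l)%:M.
Proof.
apply/matrixP => i j; rewrite !mxE mulrnAl mulrnAr -mulrnA; congr (_ *+ _).
rewrite mulnb andbC -xpair_eqE -!surjective_pairing.
by rewrite (can_eq (@mxtens_unindexK _ _)) (can_eq (@regroupK a b c d)).
Qed.

Lemma ptrans_btens X Y : ptrans (btens X Y) = btens (ptrans X) (ptrans Y).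
Proof.
apply/matrixP => i j.
case: (mxtens_indexP i) => i1 i2; case: (mxtens_indexP j) => j1 j2.
case: (mxtens_indexP i1) => ? ?; case: (mxtens_indexP i2) => ? ?.
case: (mxtens_indexP j1) => ? ?; case: (mxtens_indexP j2) => ? ?.
by rewrite mxE !mxtens_indexK /= !btensE !mxE !mxtens_indexK.
Qed.

Lemma psdmx_btens X Y : psdmx X -> psdmx Y -> psdmx (btens X Y).
Proof. by move=> pX pY; exact/psdmx_mxsub/psdmx_tens. Qed.

Lemma btens_herm X Y :
  X \is hermsymmx -> Y \is hermsymmx -> btens X Y \is hermsymmx.
Proof.
rewrite !hermsymmxE => /eqP hX /eqP hY.
by rewrite btens_trmxC -hX -hY.
Qed.
End Dimensions.
End BipartiteTensor.

(** * Feasible points: products, powers and the trace pairing *)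

Section KappaFeasible.
Variable R : realType.
Local Notation C := (complex R).

Lemma kappa_feasibleE a b (rho S : 'M[C]_(a * b)) :
  kappa_feasible rho S <->
  [/\ psdmx (S + ptrans rho), psdmx (S - ptrans rho) & psdmx (ptrans S)].
Proof.
split=> [[_ /= h1 h2 h3]|[h1 h2 h3]].
  have [p1 p2] := (psdmxN_sandwich _ _).1 (conj h1 h2).
  by rewrite /loewner subr0 in h3; split; [exact: p1|exact: p2|exact: h3].
have [p1 p2] := (psdmxN_sandwich _ _).2 (conj h1 h2).
split; [|exact: p1|exact: p2|by rewrite /loewner subr0; exact: h3].
have : psdmx S.
  by apply: psdmx_half; have := psdmxD h1 h2; rewrite addrACA subrr addr0.
by case.
Qed.

(** In (S + X) (x) (T + Y) + (S - X) (x) (T - Y) the mixed terms cancel, leaving twice S (x) T + X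
    (x) Y. *)
Lemma psdmx_btens_sandwich a b c d (S X : 'M[C]_(a * b)) (T Y : 'M[C]_(c * d)) :
  psdmx (S + X) -> psdmx (S - X) -> psdmx (T + Y) -> psdmx (T - Y) ->
  psdmx (btens S T + btens X Y).
Proof.
move=> h1 h2 h3 h4; apply: psdmx_half.
have := psdmxD (psdmx_btens h1 h3) (psdmx_btens h2 h4).
rewrite !btensDl !btensDr !btensNl !btensNr opprK.
move: (btens S T) (btens X Y) (btens S Y) (btens X T) => ST XY SY XT.
rewrite (_ : _ + _ = ST + XY + (ST + XY)) //.
by apply/matrixP => i j; rewrite !mxE; ring.
Qed.

Lemma kappa_feasible_btens a b c d (rho S : 'M[C]_(a * b)) (tau T : 'M[C]_(c * d)) :
  kappa_feasible rho S -> kappa_feasible tau T ->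
  kappa_feasible (btens rho tau) (btens S T).
Proof.
move=> /kappa_feasibleE[h1 h2 h3] /kappa_feasibleE[k1 k2 k3].
apply/kappa_feasibleE; rewrite !ptrans_btens; split.
- exact: psdmx_btens_sandwich h1 h2 k1 k2.
(* The hypotheses are symmetric in the sign of X, so the upper bound is the lower one with X
   replaced by -X. *)
- have h1' : psdmx (S - - ptrans rho) by rewrite opprK; exact: h1.
  by have := psdmx_btens_sandwich h2 h1' k1 k2; rewrite btensNl; exact.
- exact: psdmx_btens h3 k3.
Qed.

Definition local_reindex a b a' b' (f : 'I_a' -> 'I_a) (g : 'I_b' -> 'I_b)
    (i : 'I_(a' * b')) : 'I_(a * b) :=
  mxtens_index (f (mxtens_unindex i).1, g (mxtens_unindex i).2).

Section LocalReindexing.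
Variables (a b a' b' : nat) (f : 'I_a' -> 'I_a) (g : 'I_b' -> 'I_b).
Let h := local_reindex f g.

Lemma ptrans_reindex (X : 'M[C]_(a * b)) :
  ptrans (mxsub h h X) = mxsub h h (ptrans X).
Proof.
by apply/matrixP => i j; rewrite !mxE /h /local_reindex !mxtens_indexK.
Qed.

Lemma kappa_feasible_reindex (rho S : 'M[C]_(a * b)) :
  kappa_feasible rho S -> kappa_feasible (mxsub h h rho) (mxsub h h S).
Proof.
move=> /kappa_feasibleE[h1 h2 h3]; apply/kappa_feasibleE.
rewrite !ptrans_reindex.
have e (X Y : 'M[C]_(a * b)) : mxsub h h X + mxsub h h Y = mxsub h h (X + Y).
  by apply/matrixP => i j; rewrite !mxE.
have en (X : 'M[C]_(a * b)) : - mxsub h h X = mxsub h h (- X).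
  by apply/matrixP => i j; rewrite !mxE.
split; rewrite ?en ?e.
- exact: psdmx_mxsub h1.
- exact: psdmx_mxsub h2.
- exact: psdmx_mxsub h3.
Qed.

Lemma mxtrace_reindex (X : 'M[C]_(a * b)) :
  bijective f -> bijective g -> \tr (mxsub h h X) = \tr X.
Proof.
move=> [f' fK f'K] [g' gK g'K]; rewrite /mxtrace [RHS](reindex h) /=.
  by apply: eq_bigr => i _; rewrite mxE.
exists (local_reindex f' g') => i _; case: (mxtens_indexP i) => x y.
  by rewrite /h /local_reindex !mxtens_indexK fK gK.
by rewrite /h /local_reindex !mxtens_indexK f'K g'K.
Qed.
End LocalReindexing.

Definition assoc_index a b c (i : 'I_(a * (b * c))) : 'I_(a * b * c) :=
  let j := mxtens_unindex (mxtens_unindex i).2 in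
  mxtens_index (mxtens_index ((mxtens_unindex i).1, j.1), j.2).

Lemma assoc_index_bij a b c : bijective (@assoc_index a b c).
Proof.
exists (fun i => let j := mxtens_unindex (mxtens_unindex i).1 in
  mxtens_index (j.1, mxtens_index (j.2, (mxtens_unindex i).2))) => i.
  case: (mxtens_indexP i) => ? j; case: (mxtens_indexP j) => ? ?.
  by rewrite /assoc_index !mxtens_indexK.
case: (mxtens_indexP i) => j ?; case: (mxtens_indexP j) => ? ?.
by rewrite /assoc_index !mxtens_indexK.
Qed.

(** [btensX_rec] nests to the right, so its first two copies have to be brought together before a
    feasible point for a pair applies. The reindexing is local on each party and hence commutes with
    Gamma. *)
Lemma btensA a b c d e f (X : 'M[C]_(a * b)) (Y : 'M[C]_(c * d))
    (Z : 'M[C]_(e * f)) :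
  let h := local_reindex (@assoc_index a c e) (@assoc_index b d f) in
  btens X (btens Y Z) = mxsub h h (btens (btens X Y) Z).
Proof.
apply/matrixP => i j.
case: (mxtens_indexP i) => i1 i2; case: (mxtens_indexP j) => j1 j2.
case: (mxtens_indexP i1) => ? k1; case: (mxtens_indexP i2) => ? k2.
case: (mxtens_indexP j1) => ? l1; case: (mxtens_indexP j2) => ? l2.
case: (mxtens_indexP k1) => ? ?; case: (mxtens_indexP k2) => ? ?.
case: (mxtens_indexP l1) => ? ?; case: (mxtens_indexP l2) => ? ?.
rewrite [RHS]mxE /local_reindex /assoc_index !mxtens_indexK.
by rewrite !btensE mulrA.
Qed.

(* Odd powers leave one copy outside the pairs. *)
Lemma kappa_feasible_btensX a b (rho S1 : 'M[C]_(a * b))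
    (S2 : 'M[C]_((a * a) * (b * b))) :
  kappa_feasible rho S1 -> kappa_feasible (btens rho rho) S2 ->
  forall k, exists2 S, kappa_feasible (btensX_rec rho k) S &
    \tr S = \tr S2 ^+ k.+1./2 * \tr S1 ^+ odd k.+1.
Proof.
move=> f1 f2 k; suff [] : (exists2 S, kappa_feasible (btensX_rec rho k) S &
    \tr S = \tr S2 ^+ k.+1./2 * \tr S1 ^+ odd k.+1) /\
  (exists2 S, kappa_feasible (btensX_rec rho k.+1) S &
    \tr S = \tr S2 ^+ k.+2./2 * \tr S1 ^+ odd k.+2) by [].
elim: k => [|k [IH1 IH2]].
  split; first by exists S1; rewrite //= expr0 expr1 mul1r.
  by exists S2; rewrite //= expr0 expr1 mulr1.
split=> //; have [T fT trT] := IH1.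
pose n := (a ^ k.+1)%N; pose m := (b ^ k.+1)%N.
pose h := local_reindex (@assoc_index a a n) (@assoc_index b b m).
suff : exists2 S : 'M[C]_((a * (a * n)) * (b * (b * m))),
    kappa_feasible (btens rho (btens rho (btensX_rec rho k))) S &
    \tr S = \tr S2 ^+ k.+3./2 * \tr S1 ^+ odd k.+3 by [].
exists (mxsub h h (btens S2 (T : 'M[C]_(n * m)))).
  rewrite btensA; apply: kappa_feasible_reindex.
  exact: kappa_feasible_btens.
rewrite mxtrace_reindex; try exact: assoc_index_bij.
by rewrite mxtrace_btens trT /= negbK exprS mulrA.
Qed.

Lemma mxtrace_ptrans a b (X : 'M[C]_(a * b)) : \tr (ptrans X) = \tr X.
Proof.
apply: eq_bigr => i _; case: (mxtens_indexP i) => x y.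
by rewrite mxE !mxtens_indexK.
Qed.

Lemma ptransE a b (X : 'M[C]_(a * b)) x y z t :
  ptrans X (mxtens_index (x, y)) (mxtens_index (z, t)) =
  X (mxtens_index (x, t)) (mxtens_index (z, y)).
Proof. by rewrite mxE !mxtens_indexK. Qed.

Lemma ptransZ a b k (X : 'M[C]_(a * b)) : ptrans (k *: X) = k *: ptrans X.
Proof. by apply/matrixP => i j; rewrite !mxE. Qed.

Lemma ptransD a b (X Y : 'M[C]_(a * b)) : ptrans (X + Y) = ptrans X + ptrans Y.
Proof. by apply/matrixP => i j; rewrite !mxE. Qed.

(** Gamma as a permutation of matrix positions: its self-adjointness for the trace pairing is then a
    reindexing by an involution. *)
Definition pt_index a b (p : 'I_(a * b) * 'I_(a * b)) : 'I_(a * b) * 'I_(a * b) :=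
  (mxtens_index ((mxtens_unindex p.1).1, (mxtens_unindex p.2).2),
   mxtens_index ((mxtens_unindex p.2).1, (mxtens_unindex p.1).2)).

Lemma pt_indexE a b x y z t :
  @pt_index a b (mxtens_index (x, y), mxtens_index (z, t)) =
  (mxtens_index (x, t), mxtens_index (z, y)).
Proof. by rewrite /pt_index !mxtens_indexK. Qed.

Lemma pt_indexK a b : involutive (@pt_index a b).
Proof.
case=> i j; case: (mxtens_indexP i) => ? ?; case: (mxtens_indexP j) => ? ?.
by rewrite !pt_indexE.
Qed.

Lemma ptransK a b : involutive (@ptrans R a b).
Proof.
move=> X; apply/matrixP => i j.
case: (mxtens_indexP i) => ? ?; case: (mxtens_indexP j) => ? ?.
by rewrite !ptransE.
Qed.

Lemma mxtrace_mul_ptrans a b (X Y : 'M[C]_(a * b)) :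
  \tr (ptrans X *m Y) = \tr (X *m ptrans Y).
Proof.
have trE (A B : 'M[C]_(a * b)) : \tr (A *m B) = \sum_p A p.1 p.2 * B p.2 p.1.
  rewrite -(pair_big xpredT xpredT (fun i j => A i j * B j i)) /=.
  by apply: eq_bigr => i _; rewrite mxE.
rewrite !trE [RHS](reindex_inj (inv_inj (@pt_indexK a b))).
apply: eq_bigr => -[i j] _.
case: (mxtens_indexP i) => ? ?; case: (mxtens_indexP j) => ? ?.
by rewrite pt_indexE /= !ptransE.
Qed.
End KappaFeasible.

(** * Achievability by PPT channels *)

Section Channels.
Variable R : realType.
Local Notation C := (complex R).

Lemma completely_positiveD m n (L K : 'M[C]_m -> 'M[C]_n) :
  completely_positive L -> completely_positive K ->
  completely_positive (fun X => L X + K X).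
Proof.
move=> cL cK k X pX.
rewrite (_ : ampliation _ X = ampliation L X + ampliation K X).
  exact: psdmxD (cL k X pX) (cK k X pX).
by apply/matrixP => i j; rewrite !mxE.
Qed.

(** Measure-and-prepare maps: the ampliation sends X to T (x) N, where T is the partial trace of X
    compressed by a Gram factor of M. *)
Lemma completely_positive_trace m n (M : 'M[C]_m) (N : 'M[C]_n) :
  psdmx M -> psdmx N -> completely_positive (fun X => \tr (M *m X) *: N).
Proof.
move=> /psdmx_gramP[Y ->] pN k X pX.
pose V := (1%:M : 'M[C]_k) *t Y ^t*.
pose Z := V *m X *m V ^t*.
have pZ : psdmx Z by exact: psdmx_conj.
pose T := \sum_(r < m) mxsub (fun i : 'I_k => mxtens_index (i, r))
                             (fun i : 'I_k => mxtens_index (i, r)) Z.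
have pT : psdmx T by apply: psdmx_sum => r _; exact: psdmx_mxsub.
suff -> : ampliation (fun X => \tr (Y *m Y ^t* *m X) *: N) X = T *t N.
  exact: psdmx_tens.
apply/matrixP => i j; rewrite !mxE; congr (_ * _).
move: (mxtens_unindex i).1 (mxtens_unindex j).1 => {}i {}j.
rewrite -mulmxA mxtrace_mulC summxE; apply: eq_bigr => r _.
rewrite [RHS]mxE /Z [RHS]mxE [LHS]mxE.
have VE (x : 'I_k) (s : 'I_m) (y : 'I_k) (t : 'I_m) :
    V (mxtens_index (x, s)) (mxtens_index (y, t)) = (x == y)%:R * (Y t s)^*.
  by rewrite /V tensmxE !mxE.
have sumE (F : 'I_(k * m) -> C) :
    \sum_l F l = \sum_(y < k) \sum_(t < m) F (mxtens_index (y, t)).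
  rewrite pair_big (reindex (@mxtens_index k m)) /=; first by apply: eq_bigr => -[].
  by exists (@mxtens_unindex k m) => l _; rewrite ?mxtens_indexK ?mxtens_unindexK.
rewrite sumE (bigD1 j) //= [X in _ + X]big1 ?addr0 => [|y yj]; last first.
  apply: big1 => t _; rewrite [X in _ * X]mxE [X in _ * (X)^*]mxE VE.
  by rewrite eq_sym (negPf yj) mul0r conjC0 mulr0.
apply: eq_bigr => t _.
rewrite [X in _ = _ * X]mxE [X in _ = _ * (X)^*]mxE VE eqxx mul1r conjCK.
congr (_ * _); rewrite !mxE sumE (bigD1 i) //= [X in _ + X]big1 ?addr0 => [|y yi].
  by apply: eq_bigr => s _; rewrite VE eqxx mul1r !mxE.
by apply: big1 => s _; rewrite VE eq_sym (negPf yi) !mul0r.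
Qed.

(** Conjugated by Gamma, the channel is again of measure-and-prepare form, with effects proportional
    to [Ep] and [Em] and prepared operators [Np] and [Nm]. The effects are positive because P^Gamma
    lies between -1/delta and 1/delta, the prepared operators because sigma^Gamma is S / Tr S and S
    dominates both signs of rho^Gamma. *)
Lemma ppt_channel_of_feasible a b c d (P : 'M[C]_(a * b)) (rho S : 'M[C]_(c * d))
    (delta : C) :
  P \is hermsymmx -> P *m P = P -> \tr P = 1 ->
  0 < delta -> kappa_feasible P (delta^-1)%:M ->
  state rho -> kappa_feasible rho S -> 0 < \tr S -> 1 + \tr S <= delta ->
  exists L : {linear 'M[C]_(a * b) -> 'M[C]_(c * d)},
    ppt_channel L /\ L P = rho.
Proof.
move=> hP PP trP d0 /kappa_feasibleE[E1 E2 _] [prho trrho] fS trS0 trSd.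
have pS := kappa_feasible_psd fS.
have /kappa_feasibleE[S1 S2 S3] := fS.
pose sigma := (\tr S)^-1 *: ptrans S.
have trsigma : \tr sigma = 1.
  by rewrite mxtraceZ mxtrace_ptrans mulVf // gt_eqF.
have psigma : psdmx sigma by apply: psdmxZ => //; rewrite invr_ge0 ltW.
have sE : ptrans sigma = (\tr S)^-1 *: S.
  by rewrite /sigma ptransZ ptransK.
clearbody sigma.
pose f (X : 'M[C]_(a * b)) := \tr (P *m X) *: rho + \tr ((1%:M - P) *m X) *: sigma.
have f_linear : linear f.
  move=> k X Y; rewrite /f !mulmxDr -!scalemxAr !mxtraceD !mxtraceZ !scalerDl.
  by rewrite scalerDr !scalerA addrACA.
pose L : {linear 'M[C]_(a * b) -> 'M[C]_(c * d)} :=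
  HB.pack f (GRing.isLinear.Build _ _ _ _ f f_linear).
have LE X : L X = f X by [].
have tPP : P *m P ^t* = P by move: hP; rewrite hermsymmxE => /eqP <-.
have pP : psdmx P by rewrite -tPP; exact: psdmx_gram.
have pP' : psdmx (1%:M - P).
  have := psdmx_gram (1%:M - P).
  have -> : (1%:M - P) ^t* = 1%:M - P.
    move: hP; rewrite hermsymmxE => /eqP hP.
    by rewrite linearB /= map_mxB -hP trmx1 map_mx1.
  by rewrite mulmxBr mulmx1 mulmxBl mul1mx PP subrr subr0.
exists L; split; last first.
  by rewrite LE /f PP mulmxBl mul1mx PP subrr mxtrace0 scale0r addr0 trP scale1r.
split; last first.
  move=> X; rewrite LE /f mxtraceD !mxtraceZ trrho trsigma !mulr1 -mxtraceD.
  by rewrite -mulmxDl addrC subrK mul1mx.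
split.
  by apply: completely_positiveD; exact: completely_positive_trace.
pose Ep := (delta^-1)%:M + ptrans P; pose Em := (delta^-1)%:M - ptrans P.
pose Np := ptrans rho + (delta - 1) *: ptrans sigma.
pose Nm := (delta + 1) *: ptrans sigma - ptrans rho.
(* Used with k = delta - 1 and k = delta + 1; the smaller value is where 1 + Tr S <= delta is
   needed. *)
have dom (k : C) : \tr S <= k -> psdmx (k *: ptrans sigma - S).
  move=> hk; rewrite sE scalerA -[X in _ - X]scale1r -scalerBl.
  by apply: psdmxZ => //; rewrite subr_ge0 ler_pdivlMr // mul1r.
have pNp : psdmx Np.
  rewrite /Np addrC; apply: psdmx_diff_le S1 _.
  by apply: dom; rewrite lerBrDl.
have pNm : psdmx Nm.
  apply: psdmx_diff_le S2 _; apply: dom; apply: le_trans (le_trans _ trSd) _.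
    by rewrite lerDr.
  by rewrite lerDl.
(* Tr X and Tr (P^Gamma X) are recovered from the sum and the difference of the two effects. *)
have fE X : ptrans (L (ptrans X)) =
    2^-1 *: (\tr (Ep *m X) *: Np + \tr (Em *m X) *: Nm).
  have ptL : ptrans (L (ptrans X)) = \tr (ptrans P *m X) *: ptrans rho +
      (\tr X - \tr (ptrans P *m X)) *: ptrans sigma.
    rewrite LE /f mulmxBl mul1mx (raddfB (@mxtrace C _)) /= mxtrace_ptrans.
    rewrite -mxtrace_mul_ptrans ptransD !ptransZ.
    by [].
  rewrite ptL /Ep /Em /Np /Nm mulmxDl mulmxBl !mul_scalar_mx mxtraceD.
  rewrite (raddfB (@mxtrace C _)) /= !mxtraceZ.
  move: (\tr (ptrans P *m X)) (\tr X) => p x.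
  have d1 : delta^-1 * delta = 1 by rewrite mulVf // gt_eqF.
  apply/matrixP => i j; rewrite !mxE.
  have half (z : C) : z = 2^-1 * (z + z).
    by rewrite -[z + z]mulr2n -[z *+ 2]mulr_natl mulKf // pnatr_eq0.
  rewrite [LHS]half; congr (2^-1 * _).
  move: (rho _ _) (sigma _ _) => r s.
  have -> : (delta^-1 * x + p) * (r + (delta - 1) * s) + (delta^-1 * x - p) *
     ((delta + 1) * s - r) =
     2 * (p * r) + 2 * ((delta^-1 * delta) * x - p) * s by ring.
  by rewrite d1; ring.
have h0 : 0 <= 2^-1 :> C by rewrite invr_ge0 ler0n.
have cE := completely_positiveD (completely_positive_trace E1 (psdmxZ h0 pNp))
  (completely_positive_trace E2 (psdmxZ h0 pNm)).
rewrite (_ : (fun X => _) = (fun X => \tr (Ep *m X) *: (2^-1 *: Np)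
    + \tr (Em *m X) *: (2^-1 *: Nm))); first exact: cE.
apply/funext => X; rewrite fE scalerDr.
by congr (_ + _); rewrite !scalerA mulrC.
Qed.
End Channels.

(* Local diagonal unitary invariant operators (first family) and their partial
   transposes (second family); on the diagonal the two matrices d and k add up. *)
Section DiagonalInvariant.
Variable R : realType.
Local Notation C := (complex R).
Variable n : nat.
Implicit Types d k : 'M[C]_n.

Definition ldui d k : 'M[C]_(n * n) :=
  \matrix_(i, j)
    (let x := mxtens_unindex i in let y := mxtens_unindex j in
     (x == y)%:R * d x.1 x.2 + (x == (y.2, y.1))%:R * k x.1 x.2).

Definition cldui d k : 'M[C]_(n * n) :=
  \matrix_(i, j)
    (let x := mxtens_unindex i in let y := mxtens_unindex j in
     (x == y)%:R * d x.1 x.2 + ((x.1 == x.2) && (y.1 == y.2))%:R * k x.1 y.1).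

Lemma lduiE d k x1 x2 y1 y2 :
  ldui d k (mxtens_index (x1, x2)) (mxtens_index (y1, y2)) =
  ((x1, x2) == (y1, y2))%:R * d x1 x2 + ((x1, x2) == (y2, y1))%:R * k x1 x2.
Proof. by rewrite mxE !mxtens_indexK. Qed.

Lemma ldui_pairE d k x y :
  ldui d k (mxtens_index x) (mxtens_index y) =
  (x == y)%:R * d x.1 x.2 + (x == (y.2, y.1))%:R * k x.1 x.2.
Proof. by rewrite mxE !mxtens_indexK. Qed.

Lemma clduiE d k x1 x2 y1 y2 :
  cldui d k (mxtens_index (x1, x2)) (mxtens_index (y1, y2)) =
  ((x1, x2) == (y1, y2))%:R * d x1 x2 + ((x1 == x2) && (y1 == y2))%:R * k x1 y1.
Proof. by rewrite mxE !mxtens_indexK. Qed.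

Lemma ptrans_ldui d k : ptrans (ldui d k) = cldui d k.
Proof.
apply/matrixP => i j.
case: (mxtens_indexP i) => x1 x2; case: (mxtens_indexP j) => y1 y2.
rewrite ptransE lduiE clduiE !xpair_eqE [x2 == y2]eq_sym [y1 == y2]eq_sym.
congr (_ + _).
  by case: (y2 =P x2) => [->|_] //; rewrite andbF !mul0r.
by case: (y2 =P y1) => [->|_] //; rewrite andbF !mul0r.
Qed.

Lemma lduiD d k d' k' : ldui d k + ldui d' k' = ldui (d + d') (k + k').
Proof.
apply/matrixP => i j.
case: (mxtens_indexP i) => x1 x2; case: (mxtens_indexP j) => y1 y2.
by rewrite mxE !lduiE !mxE !mulrDr addrACA.
Qed.

Lemma lduiZ c d k : c *: ldui d k = ldui (c *: d) (c *: k).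
Proof.
apply/matrixP => i j.
case: (mxtens_indexP i) => x1 x2; case: (mxtens_indexP j) => y1 y2.
by rewrite mxE !lduiE !mxE mulrDr ![c * (_%:R * _)]mulrCA.
Qed.

Lemma ldui1 : ldui (const_mx 1) 0 = 1%:M.
Proof.
apply/matrixP => i j.
case: (mxtens_indexP i) => x1 x2; case: (mxtens_indexP j) => y1 y2.
by rewrite lduiE !mxE mulr0 addr0 mulr1 (can_eq (@mxtens_indexK _ _)).
Qed.

Lemma sum_pairs (F : 'I_(n * n) -> C) :
  \sum_i F i = \sum_(p : 'I_n * 'I_n) F (mxtens_index p).
Proof.
rewrite (reindex (@mxtens_index n n)) //.
by exists (@mxtens_unindex n n) => l _; rewrite ?mxtens_indexK ?mxtens_unindexK.
Qed.

Lemma sum_ldui d k (p : 'I_n * 'I_n) (F : 'I_(n * n) -> C) :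
  \sum_j ldui d k (mxtens_index p) j * F j =
  d p.1 p.2 * F (mxtens_index p) + k p.1 p.2 * F (mxtens_index (p.2, p.1)).
Proof.
rewrite sum_pairs (eq_bigr (fun q =>
  (p == q)%:R * d p.1 p.2 * F (mxtens_index q) +
  (p == (q.2, q.1))%:R * k p.1 p.2 * F (mxtens_index q))); last first.
  by move=> q _; rewrite ldui_pairE mulrDl.
rewrite big_split /=; congr (_ + _).
  rewrite (bigD1 p) //= big1 ?addr0 => [|q qp]; first by rewrite eqxx mul1r.
  by rewrite eq_sym (negPf qp) !mul0r.
rewrite (bigD1 (p.2, p.1)) //= big1 ?addr0 => [|q qp].
  by rewrite -surjective_pairing eqxx mul1r.
rewrite (_ : (_ == _) = false) ?mul0r //; apply/negbTE; apply: contra qp.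
by move=> /eqP->; rewrite -surjective_pairing.
Qed.

Lemma mxtrace_ldui_mul d k d' k' : \tr (ldui d k *m ldui d' k') =
  \sum_(p : 'I_n * 'I_n)
    (d p.1 p.2 * (d' p.1 p.2 + (p.1 == p.2)%:R * k' p.1 p.2) +
     k p.1 p.2 * ((p.1 == p.2)%:R * d' p.1 p.2 + k' p.2 p.1)).
Proof.
rewrite /mxtrace sum_pairs; apply: eq_bigr => -[x y] _.
rewrite mxE sum_ldui /= !lduiE !xpair_eqE !eqxx !mul1r [y == x]eq_sym.
congr (_ * (_ + _) + _ * (_ + _)); first by case: eqP.
by case: eqP => [->|]; rewrite ?mul0r.
Qed.

(** The operator splits into the numbers d_ii + k_ii on |ii> and, for i != j, 2 x 2 blocks on
    span(|ij>, |ji>) with equal diagonal entries d_ij and off-diagonal entry k_ij. *)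
Lemma psdmx_ldui d k :
  (forall i j, k i j = (k j i)^*) -> (forall i j, d i j = d j i) ->
  (forall i j, i != j -> `|k i j| <= d i j) ->
  (forall i, 0 <= d i i + k i i) -> psdmx (ldui d k).
Proof.
move=> hk hd hdk hdiag.
have d_real i j : (d i j)^* = d i j.
  have [<-|ij] := eqVneq i j; last first.
    by apply: geC0_conj; apply: le_trans (hdk i j ij).
  have := geC0_conj (hdiag i); rewrite rmorphD /= -hk.
  by move/addIr.
split.
  apply/hermsymmxP => i j.
  case: (mxtens_indexP i) => x1 x2; case: (mxtens_indexP j) => y1 y2.
  rewrite !lduiE rmorphD !rmorphM /= !conjC_nat d_real -hk !xpair_eqE.
  rewrite [y1 == x1]eq_sym [y2 == x2]eq_sym [y1 == x2]eq_sym [y2 == x1]eq_sym.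
  congr (_ + _).
    by case: (x1 =P y1) => [->|_]; [case: (x2 =P y2) => [->|_] |];
      rewrite ?mul0r.
  rewrite andbC.
  by case: (x2 =P y1) => [->|_]; [case: (x1 =P y2) => [->|_] |];
      rewrite ?mul0r ?andbF ?mul0r.
move=> v; pose w (p : 'I_n * 'I_n) := v (mxtens_index p) 0.
pose t p := d p.1 p.2 * ((w p)^* * w p) + k p.1 p.2 * ((w p)^* * w (p.2, p.1)).
have -> : (v ^t* *m ldui d k *m v) 0 0 = \sum_p t p.
  rewrite -mulmxA mxE sum_pairs; apply: eq_bigr => p _.
  rewrite [(ldui d k *m v) _ _]mxE (sum_ldui d k p (fun l => v l 0)) !mxE.
  by rewrite /t /w mulrDr; congr (_ + _); rewrite mulrCA.
pose s (p : 'I_n * 'I_n) := (p.2, p.1).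
have sK : involutive s by case.
(* Adding the contributions of |xy> and |yx> yields the quadratic form of one block; summing over
   all p then counts the whole form twice. *)
have t0 p : 0 <= t p + t (s p).
  case: p => x y; rewrite /t /s /=; set a := w (x, y); set b := w (y, x).
  have [xy|xy] := eqVneq x y.
    have aa : 0 <= (d x x + k x x) * (a^* * a).
      by apply: mulr_ge0 (hdiag x) _; rewrite mulrC mul_conjC_ge0.
    by move: aa; rewrite /a /b -xy mulrDl => aa; exact: addr_ge0.
  have -> : d x y * (a^* * a) + k x y * (a^* * b) +
      (d y x * (b^* * b) + k y x * (b^* * a)) =
      d x y * (a^* * a + b^* * b) + (k x y * (a^* * b) + (k x y * (a^* * b))^*).
    rewrite !rmorphM /= conjCK -hk (hd y x); move: (a^*) (b^*) => a' b'.
    ring.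
  set z := k x y * _.
  have zr : z + z^* \is Num.real by apply/CrealP; rewrite rmorphD /= conjCK addrC.
  have zn : `|z + z^*| <= 2 * `|z|.
    by apply: le_trans (ler_normD _ _) _; rewrite norm_conjC mulr_natl mulr2n.
  rewrite -lerBlDr sub0r; apply: le_trans (_ : `|z + z^*| <= _).
    by rewrite -normrN real_ler_norm // realN.
  apply: le_trans zn _; rewrite /z !normrM norm_conjC.
  rewrite ![_^* * _]mulrC -!normCK.
  have ab : 2 * (`|a| * `|b|) <= `|a| ^+ 2 + `|b| ^+ 2.
    by rewrite mulr_natl -subr_ge0 addrAC -sqrrB -realEsqr realB.
  apply: le_trans (_ : d x y * (2 * (`|a| * `|b|)) <= _); last first.
    by rewrite ler_wpM2l // (le_trans _ (hdk x y xy)).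
  by rewrite mulrCA ler_wpM2r ?hdk // mulr_ge0 // mulr_ge0.
have half (z : C) : 0 <= z + z -> 0 <= z.
  by rewrite -mulr2n pmulrn_lge0.
apply: half; rewrite {2}(reindex_inj (inv_inj sK)) -big_split.
by apply: sumr_ge0 => p _; exact: t0.
Qed.

(** A diagonal operator plus k carried to span(|jj>) by the isometry |j> -> |jj>. *)
Lemma psdmx_cldui d k : (forall i j, 0 <= d i j) -> psdmx k -> psdmx (cldui d k).
Proof.
move=> hd pk.
pose D : 'rV[C]_(n * n) := \row_i d (mxtens_unindex i).1 (mxtens_unindex i).2.
pose V : 'M[C]_(n * n, n) := \matrix_(i, j) (mxtens_unindex i == (j, j))%:R.
have pD : psdmx (diag_mx D).
  have [|Y YE] := @diag_gram R _ _ (1%:M : 'M[C]_(n * n)) D.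
    by move=> i; rewrite mxE.
  have -> : diag_mx D = Y *m Y ^t*.
    by rewrite -YE mul1mx trmx1 map_mx1 mulmx1.
  exact: psdmx_gram.
suff -> : cldui d k = diag_mx D + V *m k *m V ^t*.
  exact: psdmxD pD (psdmx_conj V pk).
apply/matrixP => i j.
case: (mxtens_indexP i) => x1 x2; case: (mxtens_indexP j) => y1 y2.
rewrite clduiE [RHS]mxE; congr (_ + _).
  rewrite !mxE mxtens_indexK (can_eq (@mxtens_indexK n n)) /=.
  by rewrite -[RHS]mulr_natl.
have VE (z1 z2 l : 'I_n) (F : 'I_n -> C) :
    \sum_l V (mxtens_index (z1, z2)) l * F l = (z1 == z2)%:R * F z1.
  rewrite (bigD1 z1) //= big1 ?addr0 => [|m mz].
    by rewrite mxE mxtens_indexK xpair_eqE eqxx /= eq_sym.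
  by rewrite mxE mxtens_indexK xpair_eqE eq_sym (negPf mz) mul0r.
rewrite mxE.
under eq_bigr => l _ do rewrite [(V ^t*) _ _]mxE [V^T _ _]mxE mulrC.
have -> : \sum_l (V (mxtens_index (y1, y2)) l)^* * (V *m k) (mxtens_index (x1, x2)) l
  = \sum_l V (mxtens_index (y1, y2)) l * (V *m k) (mxtens_index (x1, x2)) l.
  by apply: eq_bigr => l _; rewrite mxE conjC_nat.
by rewrite VE // mxE VE // mulrA -natrM mulnb andbC.
Qed.

End DiagonalInvariant.

(** * Powers of the maximally entangled state and the resulting bound on the cost *)

Section EntangledPowers.
Variable R : realType.
Local Notation C := (complex R).

Lemma invr_sqrtC2_sq : (sqrtC 2)^-1 * ((sqrtC 2)^-1)^* = 2^-1 :> C.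
Proof.
rewrite geC0_conj ?invr_ge0 ?sqrtC_ge0 ?ler0n //.
by rewrite -invfM -expr2 sqrtCK.
Qed.

Lemma Phi2_ketE x y :
  Phi2_ket R (mxtens_index (x, y)) 0 = (sqrtC 2)^-1 * (x == y)%:R.
Proof.
rewrite mxE summxE; congr (_ * _).
rewrite (bigD1 x) //= big1 ?addr0 => [|i ix]; rewrite mxE eqxx andbT
  (can_eq (@mxtens_indexK 2 2)) xpair_eqE.
  by rewrite eqxx eq_sym.
by rewrite eq_sym (negPf ix).
Qed.

Lemma Phi2E : Phi2 R = cldui 0 (const_mx 2^-1).
Proof.
apply/matrixP => i j.
case: (mxtens_indexP i) => x1 x2; case: (mxtens_indexP j) => y1 y2.
rewrite clduiE mxE big_ord1 [(Phi2_ket R ^t*) _ _]mxE [(_ ^T) _ _]mxE.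
rewrite !Phi2_ketE rmorphM /= conjC_nat mulrACA invr_sqrtC2_sq !mxE.
by rewrite mulr0 add0r -natrM mulnb mulrC.
Qed.

Lemma Phi2_norm : Phi2_ket R ^t* *m Phi2_ket R = 1%:M.
Proof.
apply/matrixP => i j; rewrite !ord1 mxE (sum_pairs (n := 2)) mxE eqxx mulr1n.
rewrite (eq_bigr (fun p : 'I_2 * 'I_2 => 2^-1 * (p.1 == p.2)%:R)); last first.
  move=> [x y] _; rewrite [(_ ^t*) _ _]mxE [(_ ^T) _ _]mxE !Phi2_ketE.
  rewrite rmorphM /= conjC_nat mulrACA [_^* * _]mulrC invr_sqrtC2_sq.
  by rewrite -natrM mulnb andbb.
rewrite -mulr_sumr -(pair_big xpredT xpredT (fun x y => (x == y)%:R)) /=.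
rewrite !big_ord_recl !big_ord0 /= !add0r !addr0.
by rewrite -[1 + 1]/(2%:R) mulVf // pnatr_eq0.
Qed.

Lemma Phi2_projector :
  [/\ Phi2 R \is hermsymmx, Phi2 R *m Phi2 R = Phi2 R & \tr (Phi2 R) = 1].
Proof.
split.
- by have [] := psdmx_gram (Phi2_ket R).
- by rewrite /Phi2 -mulmxA [X in _ *m X]mulmxA Phi2_norm mul1mx.
- by rewrite /Phi2 mxtrace_mulC Phi2_norm mxtrace1.
Qed.

Lemma Phi2_kappa : kappa_feasible (Phi2 R) (2^-1)%:M.
Proof.
have h0 : 0 <= 2^-1 :> C by rewrite invr_ge0 ler0n.
have hc : (2^-1)^* = 2^-1 :> C by exact: geC0_conj.
have hM : (2^-1)%:M = ldui (const_mx 2^-1) 0 :> 'M[C]_(2 * 2).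
  by rewrite -scalemx1 -ldui1 lduiZ scaler0; congr ldui; apply/matrixP => i j;
    rewrite !mxE mulr1.
have hP : ptrans (Phi2 R) = ldui 0 (const_mx 2^-1).
  by rewrite Phi2E -ptrans_ldui ptransK.
apply/kappa_feasibleE; rewrite hP; split.
- rewrite [X in psdmx (X + _)]hM lduiD; apply: psdmx_ldui => [i j|i j|i j _|i];
    rewrite !mxE ?addr0 ?add0r ?hc //.
  by rewrite ger0_norm.
- rewrite [X in psdmx (X - _)]hM -scaleN1r lduiZ lduiD.
  apply: psdmx_ldui => [i j|i j|i j _|i];
    rewrite !mxE ?mulr0 ?addr0 ?add0r ?mulN1r ?rmorphN /= ?hc ?normrN //.
  + by rewrite ger0_norm.
  + by rewrite subrr.
- rewrite ptrans_scalar -scalemx1; apply: psdmxZ h0 _; exact: psdmx1.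
Qed.

(** The bound on the partial transpose is stored as feasibility of a scalar, so multiplicativity of
    feasible points carries it through the induction without describing the swap on m pairs. *)
Lemma btensX_Phi2 m : let P := btensX (Phi2 R) m in
  [/\ P \is hermsymmx, P *m P = P, \tr P = 1 &
      kappa_feasible P ((2 ^+ m)^-1)%:M].
Proof.
have [h1 h2 h3] := Phi2_projector.
case: m => [|m] /=.
  split; [exact: hermitian1mx_subproof|exact: mulmx1|exact: mxtrace1|].
  have p1 := @psdmx1 R (2 ^ 0 * 2 ^ 0).
  apply/kappa_feasibleE; rewrite expr0 invr1 ptrans_scalar; split.
  - exact: (psdmxD p1 p1).
  - by rewrite subrr; exact: psdmx0.
  - exact: p1.
elim: m => [|m [IH1 IH2 IH3 IH4]] /=.
  by split; [exact: h1|exact: h2|exact: h3|rewrite expr1; exact: Phi2_kappa].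
split.
- exact: btens_herm.
- by rewrite btensM h2 IH2.
- by rewrite mxtrace_btens h3 IH3 mulr1.
- have := kappa_feasible_btens Phi2_kappa IH4.
  by rewrite btens_scalar -invfM -exprS; exact.
Qed.

Lemma state_btens a b c d (X : 'M[C]_(a * b)) (Y : 'M[C]_(c * d)) :
  state X -> state Y -> state (btens X Y).
Proof.
move=> [pX tX] [pY tY]; split; first exact: psdmx_btens.
by rewrite mxtrace_btens tX tY mulr1.
Qed.

Lemma state_btensX_rec a b (X : 'M[C]_(a * b)) k :
  state X -> state (btensX_rec X k).
Proof. by move=> sX; elim: k => [|k IH] //=; exact: state_btens. Qed.

Lemma kappa_feasible_trace_ge a b (rho S : 'M[C]_(a * b)) :
  kappa_feasible rho S -> \tr rho <= \tr S.
Proof.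
move=> /kappa_feasibleE[_ /psdmx_trace h _]; move: h.
by rewrite (raddfB (@mxtrace C _)) /= mxtrace_ptrans subr_ge0.
Qed.

Lemma kappa_trace_real a b (rho S : 'M[C]_(a * b)) :
  kappa_feasible rho S -> \tr S = real_complex R (complex.Re (\tr S)).
Proof.
move=> /kappa_feasible_psd/psdmx_trace; case: (\tr S) => x y.
by rewrite lecE /= => /andP[/eqP -> _].
Qed.

Lemma kappa_trace_ge1 a b (rho S : 'M[C]_(a * b)) :
  state rho -> kappa_feasible rho S -> 1 <= complex.Re (\tr S).
Proof.
move=> [_ t1] fS; have := kappa_feasible_trace_ge fS.
by rewrite t1 (kappa_trace_real fS) lecE /= => /andP[].
Qed.

Lemma truncn_exp_dominates (r t1 t2 : R) :
  0 <= r -> 1 <= t1 -> 1 <= t2 -> log2 t2 < 2 * r ->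
  \forall n \near \oo%classic,
    1 + t2 ^+ n./2 * t1 ^+ odd n <= 2 ^+ Num.truncn (r * n%:R).
Proof.
move=> r0 h1 h2 hr; pose e := 2 * r - log2 t2.
have e0 : 0 < e by rewrite subr_gt0.
have ln20 : 0 < ln (2 : R) by apply: ln_gt0; rewrite ltr1n.
have t10 : 0 < t1 by exact: lt_le_trans h1.
have t20 : 0 < t2 by exact: lt_le_trans h2.
near=> n.
set m := Num.truncn _.
have hm : r * n%:R < m%:R + 1.
  by rewrite natr1; apply: truncnS_gt.
have l20 : 0 <= ln t2 by exact: ln_ge0.
have l10 : 0 <= ln t1 by exact: ln_ge0.
(* Each copy gains e ln 2 / 2. One ln 2 pays for the summand 1, the other for the floor, and ln t1
   for the unpaired copy. *)
have hn : (2 * ln 2 + ln t1) / (e * ln 2 / 2) <= n%:R :> R.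
  by near: n; exact: nbhs_infty_ger.
rewrite ler_pdivrMr in hn; last by rewrite divr_gt0 // mulr_gt0.
have a1 : 1 <= t2 ^+ n./2 by exact: exprn_ege1.
have a2 : t1 ^+ odd n <= t1 by case: (odd n); rewrite ?expr1 ?expr0.
have a3 : 1 <= t1 ^+ odd n by exact: exprn_ege1.
apply: le_trans (_ : 2 * (t2 ^+ n./2 * t1) <= _).
  have c1 : t2 ^+ n./2 * t1 ^+ odd n <= t2 ^+ n./2 * t1.
    by rewrite ler_wpM2l // (le_trans ler01).
  have c2 : 1 <= t2 ^+ n./2 * t1 by rewrite mulr_ege1.
  by rewrite mulr_natl mulr2n lerD.
rewrite -ler_ln ?posrE ?mulr_gt0 ?exprn_gt0 // !lnM ?posrE ?mulr_gt0 ?exprn_gt0 //.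
rewrite !lnXn //.
have b1 : ln t2 *+ n./2 <= ln t2 * n%:R / 2.
  rewrite -[X in X <= _]mulr_natr -mulrA; apply: ler_wpM2l => //.
  rewrite ler_pdivlMr // -natrM ler_nat.
  by rewrite muln2 -{2}(odd_double_half n) leq_addl.
have l2E : ln t2 = log2 t2 * ln 2 by rewrite /log2 divfK // gt_eqF.
have b2 : ln t2 * n%:R / 2 = (r - e / 2) * n%:R * ln 2.
  by rewrite l2E /e; field.
rewrite -[X in _ <= X]mulr_natr.
have b3 : (r * n%:R - 1) * ln 2 <= m%:R * ln 2.
  by apply: ler_wpM2r; [exact: ltW|rewrite lerBlDr; exact: ltW].
apply: le_trans (_ : (r * n%:R - 1) * ln 2 <= _); last by rewrite [ln 2 * _]mulrC.
apply: le_trans (lerD (lexx _) (lerD b1 (lexx _))) _.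
rewrite b2 -subr_ge0.
rewrite (_ : _ - _ = n%:R * (e * ln 2 / 2) - (2 * ln 2 + ln t1)); last by field.
by rewrite subr_ge0.
Unshelve. all: by end_near.
Qed.

Lemma achievable_of_feasible a b (rho S1 : 'M[C]_(a * b))
    (S2 : 'M[C]_((a * a) * (b * b))) (r : R) :
  state rho -> kappa_feasible rho S1 -> kappa_feasible (btens rho rho) S2 ->
  0 <= r -> log2 (complex.Re (\tr S2)) < 2 * r -> achievable_rate rho r.
Proof.
move=> srho f1 f2 r0 hr; split=> //.
have t1 := kappa_trace_ge1 srho f1.
have t2 := kappa_trace_ge1 (state_btens srho srho) f2.
(* For positive n, [btensX] reduces to [btensX_rec], on which the feasible powers are built. *)
suff key n : (0 < n)%N ->
    1 + complex.Re (\tr S2) ^+ n./2 * complex.Re (\tr S1) ^+ odd n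
      <= 2 ^+ Num.truncn (r * n%:R) ->
    exists L : {linear 'M[C]_(2 ^ Num.truncn (r * n%:R) *
                              2 ^ Num.truncn (r * n%:R)) ->
                       'M[C]_(a ^ n * b ^ n)},
      ppt_channel L /\
      L (btensX (Phi2 R) (Num.truncn (r * n%:R))) = btensX rho n.
  have hN := truncn_exp_dominates r0 t1 t2 hr.
  near=> n; apply: key; first by near: n; exact: nbhs_infty_gt.
  by near: n; exact: hN.
case: n => // n _; set m := Num.truncn _ => hm.
have [hP PP trP fP] := btensX_Phi2 m.
have [S fS trS] := kappa_feasible_btensX f1 f2 n.
have srho' := state_btensX_rec n srho.
have tS := kappa_trace_ge1 srho' fS.
have tS0 : 0 < \tr S by rewrite (kappa_trace_real fS) ltcR (lt_le_trans _ tS).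
apply: (ppt_channel_of_feasible hP PP trP _ fP srho' fS tS0).
  by rewrite exprn_gt0 // ltr0n.
rewrite trS (kappa_trace_real f1) (kappa_trace_real f2).
rewrite -(rmorph1 (real_complex R)) -(rmorph_nat (real_complex R) 2).
by rewrite -!(rmorphXn (real_complex R)) -rmorphM -rmorphD lecR.
Unshelve. all: by end_near.
Qed.

Lemma Ec_ppt_exact_le a b (rho S1 : 'M[C]_(a * b)) :
  state rho -> kappa_feasible rho S1 ->
  (2%:E * Ec_ppt_exact rho <= (Ekappa (btens rho rho))%:E)%E.
Proof.
move=> srho f1; have srho2 := state_btens srho srho.
have [S2 [f2 _ ->]] := Ekappa_minE srho2.1.1.
have t2 := kappa_trace_ge1 srho2 f2.
set E := log2 _.
have E0 : 0 <= E.
  by rewrite divr_ge0 // ln_ge0 // ler1n.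
have -> : E%:E = (2%:E * (E / 2)%:E)%E :> \bar R.
  by rewrite -EFinM; congr (_%:E); field.
rewrite lee_pmul2l //.
apply/lee_addgt0Pr => e e0; apply: ge_ereal_inf.
exists (E / 2 + e)%:E; last by rewrite EFinD.
exists (E / 2 + e) => //; apply: achievable_of_feasible srho f1 f2 _ _.
  by apply: addr_ge0; [exact: divr_ge0|exact: ltW].
rewrite -/E mulrDr mulrCA divff ?pnatr_eq0 // mulr1 ltrDl.
by rewrite mulr_gt0.
Qed.
End EntangledPowers.

(** * Local diagonal unitary invariant operators on two qutrits *)

Section ThreeByThree.
Variable R : realType.
Local Notation C := (complex R).
Local Notation toC := (real_complex R).

(* Coordinates: weights of the projectors onto span(11, 22), 33, 12 + 21,
   12 - 21, span(13 + 31, 23 + 32), span(13 - 31, 23 - 32), and the weight of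
   i(|13><31| - |31><13| + |23><32| - |32><23|). *)
Definition dmx3 (z : seq R) : 'M[C]_3 :=
  \matrix_(x, y) toC (if x == y then 0 else
    if (x < 2)%N && (y < 2)%N then (z`_2 + z`_3) / 2 else (z`_4 + z`_5) / 2).

Definition kmx3 (z : seq R) : 'M[C]_3 :=
  \matrix_(x, y) (if x == y then toC (if (x < 2)%N then z`_0 else z`_1) else
    if (x < 2)%N && (y < 2)%N then toC ((z`_2 - z`_3) / 2) else
    Complex ((z`_4 - z`_5) / 2) (if (x < 2)%N then z`_6 else - z`_6)).

Definition op3 (z : seq R) : 'M[C]_(3 * 3) := ldui (dmx3 z) (kmx3 z).

Definition unit_coord (i : nat) : seq R := rcons (nseq i 0) 1.

Lemma op3_sum z : op3 z = \sum_(i <- iota 0 7) toC z`_i *: op3 (unit_coord i).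
Proof.
have iotaE : iota 0 7 = [:: 0; 1; 2; 3; 4; 5; 6]%N by [].
have DE x y : dmx3 z x y = \sum_(i <- iota 0 7) toC z`_i * dmx3 (unit_coord i) x y.
  rewrite iotaE !big_cons big_nil addr0 !mxE -!rmorphM -!rmorphD; congr (toC _).
  by case: (x == y); case: ((x < 2)%N && (y < 2)%N); rewrite /=; ring.
have KE x y : kmx3 z x y = \sum_(i <- iota 0 7) toC z`_i * kmx3 (unit_coord i) x y.
  rewrite iotaE !big_cons big_nil addr0 !mxE.
  case: (x == y); [|case: ((x < 2)%N && (y < 2)%N)].
  - by case: (x < 2)%N; rewrite -!rmorphM -!rmorphD; congr (toC _); rewrite /=; ring.
  - by rewrite -!rmorphM -!rmorphD; congr (toC _); rewrite /=; ring.
  by case: (x < 2)%N; rewrite /=; apply/eqP; rewrite eq_complex /=;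
    apply/andP; split; apply/eqP; ring.
apply/matrixP => i j; rewrite summxE.
case: (mxtens_indexP i) => x1 x2; case: (mxtens_indexP j) => y1 y2.
rewrite lduiE DE KE !mulr_sumr -big_split; apply: eq_bigr => l _.
rewrite (_ : (toC z`_l *: op3 (unit_coord l)) _ _ = toC z`_l * op3 (unit_coord l)
  (mxtens_index (x1, x2)) (mxtens_index (y1, y2))); last by rewrite mxE.
by rewrite lduiE mulrDr; congr (_ + _); rewrite mulrCA.
Qed.

Lemma dmx3_off z x y : x != y -> dmx3 z x y =
  toC (if (x < 2)%N && (y < 2)%N then (z`_2 + z`_3) / 2 else (z`_4 + z`_5) / 2).
Proof. by move=> /negPf xy; rewrite mxE xy. Qed.

Lemma kmx3_herm z x y : kmx3 z x y = (kmx3 z y x)^*.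
Proof.
rewrite !mxE; have [<-|xy] := eqVneq x y.
  by apply/eqP; rewrite eq_complex /= oppr0 !eqxx.
rewrite andbC.
have [y2|y2] := boolP (y < 2)%N; have [x2|x2] := boolP (x < 2)%N;
  apply/eqP; rewrite eq_complex /= ?oppr0 ?opprK ?eqxx //.
exfalso; move: xy y2 x2; case: x => -[|[|[|?]]] ? //; case: y => -[|[|[|?]]] ? //.
Qed.

Lemma psdmx_op3 z : 0 <= z`_0 -> 0 <= z`_1 -> 0 <= z`_2 -> 0 <= z`_3 ->
  0 <= z`_4 -> 0 <= z`_5 -> z`_6 ^+ 2 <= z`_4 * z`_5 -> psdmx (op3 z).
Proof.
move=> z0 z1 z2 z3 z4 z5 z6; apply: psdmx_ldui => [x y|x y|x y xy|x].
- exact: kmx3_herm.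
- by rewrite !mxE eq_sym andbC.
- rewrite dmx3_off // mxE (negPf xy); case: ifP => [_|xy2].
    rewrite normc_def /= lecR expr0n addr0 sqrtr_sqr ler_norml.
    by apply/andP; split; lra.
  rewrite normc_def /= lecR (_ : _ + _ = ((z`_4 - z`_5) / 2) ^+ 2 + z`_6 ^+ 2).
    rewrite -[X in _ <= X]ger0_norm; last by lra.
    by rewrite -sqrtr_sqr ler_wsqrtr //; nra.
  by case: (x < 2)%N; rewrite ?sqrrN.
- rewrite !mxE eqxx add0r; case: ifP => _; rewrite lecE /= eqxx //.
Qed.

Lemma psdmx_unit_coord i : (i < 6)%N -> psdmx (op3 (unit_coord i)).
Proof.
case: i => [|[|[|[|[|[|//]]]]]] _; apply: psdmx_op3;
by rewrite /= ?expr0n ?mulr0 ?mul0r ?ler01.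
Qed.

Lemma psdmx_ptrans_op3 z (u : 'cV[C]_3) : 0 <= z`_2 + z`_3 -> 0 <= z`_4 + z`_5 ->
  kmx3 z = u *m u ^t* -> psdmx (ptrans (op3 z)).
Proof.
move=> h1 h2 ku; rewrite ptrans_ldui; apply: psdmx_cldui => [x y|].
  by rewrite mxE lecR; case: ifP => // _; case: ifP => _; rewrite divr_ge0.
by rewrite ku; exact: psdmx_gram.
Qed.

(** The eigenvalues of 7 pi_0^Gamma on the six spectral subspaces, followed by the vanishing
    imaginary coordinate. *)
Definition lambda0 : seq R := [:: 1; 1; 1; -1; 2; 0; 0].

Lemma pi0E : pi0 R = ptrans ((7%:R)^-1 *: op3 lambda0).
Proof.
rewrite ptransZ ptrans_ldui; congr (_ *: _).
apply/matrixP => i j.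
case: (mxtens_indexP i) => x1 x2; case: (mxtens_indexP j) => y1 y2.
rewrite clduiE mxE [X in X + _]summxE [X in _ + X]summxE [RHS]addrC.
pose idE := can_eq (@mxtens_indexK 3 3).
congr (_ + _).
  rewrite (bigD1 x1) //= [X in _ + X]big1 ?addr0 => [|l lx]; last first.
    rewrite summxE big1 // => m _.
    by rewrite mxE idE xpair_eqE [x1 == l]eq_sym (negPf lx).
  rewrite summxE (bigD1 y1) //= big1 ?addr0 => [|m my]; last first.
    by rewrite mxE !idE !xpair_eqE [y1 == m]eq_sym (negPf my) andbF.
  rewrite mxE !idE !xpair_eqE !eqxx /= ![_ == x1]eq_sym ![_ == y1]eq_sym.
  rewrite (_ : kmx3 lambda0 x1 y1 = 1) ?mulr1 // mxE /=.
  case: (x1 == y1); [by case: ifP|case: ifP => _].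
    by rewrite opprK -[1 + 1]/(2%:R) divff ?pnatr_eq0.
  by rewrite subr0 divff ?pnatr_eq0 // oppr0; case: ifP.
rewrite (bigD1 x1) //= [X in _ + X]big1 ?addr0 => [|l lx]; last first.
  rewrite summxE big1 // => m _.
  by rewrite !mxE idE xpair_eqE [x1 == l]eq_sym (negPf lx) mulr0.
rewrite summxE; have [xx|xx] := eqVneq x1 x2.
  rewrite big1 => [|m mx]; last first.
    by rewrite !mxE !idE !xpair_eqE -xx [x1 == m]eq_sym (negPf mx) andbF mulr0.
  by rewrite mxE xx eqxx rmorph0 mulr0.
rewrite (bigD1 x2) 1?eq_sym //= big1 ?addr0 => [|m /andP[_ my]]; last first.
  by rewrite !mxE !idE !xpair_eqE [x2 == m]eq_sym (negPf my) andbF mulr0.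
rewrite mxE [delta_mx _ _ _ _]mxE !idE eqxx /= [_ == (x1, x2)]eq_sym mulrC.
congr (_ * _); rewrite dmx3_off //= !mxE.
move: xx; case: x1 => -[|[|[|?]]] ? //; case: x2 => -[|[|[|?]]] ? //= _.
all: by rewrite ?subrr ?mul0r ?addr0 ?divff ?pnatr_eq0.
Qed.

Lemma ptrans_pi0E : ptrans (pi0 R) = (7%:R)^-1 *: op3 lambda0.
Proof. by rewrite pi0E ptransK. Qed.

Lemma mxtrace_lambda0_mul z :
  \tr (op3 lambda0 *m op3 z) =
  toC (2 * z`_0 + z`_1 + z`_2 - z`_3 + 4 * z`_4).
Proof.
rewrite mxtrace_ldui_mul.
rewrite -(pair_big xpredT xpredT (fun x y => dmx3 lambda0 x y *
   (dmx3 z x y + (x == y)%:R * kmx3 z x y) + kmx3 lambda0 x y *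
   ((x == y)%:R * dmx3 z x y + kmx3 z y x))) /=.
rewrite !big_ord_recl !big_ord0 !mxE /= ?mulr0 ?mul0r ?mul1r ?mulr1 ?addr0.
by apply/eqP; rewrite eq_complex /=; apply/andP; split; apply/eqP; field.
Qed.
End ThreeByThree.

(** * Dual bounds *)

Section LowerBounds.
Variable R : realType.
Local Notation C := (complex R).
Local Notation toC := (real_complex R).

(** Weak duality: each positive X yields a linear lower bound on S. *)
Lemma kappa_pairing_ge a b (rho S X : 'M[C]_(a * b)) :
  kappa_feasible rho S -> psdmx X ->
  `|complex.Re (\tr (ptrans rho *m X))| <= complex.Re (\tr (S *m X)).
Proof.
move=> /kappa_feasibleE[h1 h2 _] pX.
have := mxtrace_psd_mul h1 pX; have := mxtrace_psd_mul h2 pX.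
rewrite mulmxBl mulmxDl (raddfB (@mxtrace C _)) mxtraceD /=.
move: (\tr (S *m X)) (\tr (ptrans rho *m X)) => [s s'] [t t'].
rewrite !lecE /= => /andP[_ l1] /andP[_ l2].
by rewrite ler_norml; apply/andP; split; lra.
Qed.

Lemma kappa_pairing_ptrans a b (rho S Z : 'M[C]_(a * b)) :
  kappa_feasible rho S -> psdmx Z -> 0 <= complex.Re (\tr (S *m ptrans Z)).
Proof.
move=> /kappa_feasibleE[_ _ h3] pZ.
have := mxtrace_psd_mul h3 pZ; rewrite mxtrace_mul_ptrans.
by case: (\tr _) => x y; rewrite lecE => /andP[].
Qed.

Local Notation V u v := (cldui 0 (u *m v ^t*)).

(* The projector, up to scaling, onto [al a (x) b + be c (x) d], where each
   factor is read as a vector of the span of the [|xx>] of its copy. *)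
Lemma psdmx_superposition n (a b c d : 'cV[C]_n) (al be : R) :
  psdmx (toC (al * al) *: btens (V a a) (V b b) +
         toC (be * be) *: btens (V c c) (V d d) +
         toC (al * be) *: (btens (V a c) (V b d) + btens (V c a) (V d b))).
Proof.
pose W (u v : 'cV[C]_n) := cldui 0 (u *m v ^t*).
pose k (u : 'cV[C]_n) (i : 'I_(n * n)) : C :=
  ((mxtens_unindex i).1 == (mxtens_unindex i).2)%:R * u (mxtens_unindex i).1 0.
have WE u v i j : W u v i j = k u i * (k v j)^*.
  case: (mxtens_indexP i) => x1 x2; case: (mxtens_indexP j) => y1 y2.
  rewrite clduiE mxE mulr0 add0r mxE big_ord1 !mxE /k !mxtens_indexK.
  by rewrite rmorphM /= conjC_nat mulrACA -natrM mulnb.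
pose v : 'cV[C]_((n * n) * (n * n)) := \col_i
  (let p := mxtens_unindex (regroup i) in
   toC al * (k a p.1 * k b p.2) + toC be * (k c p.1 * k d p.2)).
rewrite -!/(W _ _).
suff -> : toC (al * al) *: btens (W a a) (W b b) +
    toC (be * be) *: btens (W c c) (W d d) +
    toC (al * be) *: (btens (W a c) (W b d) + btens (W c a) (W d b)) = v *m v ^t*.
  exact: psdmx_gram.
have bE (X Y : 'M[C]_(n * n)) i j : btens X Y i j =
    X (mxtens_unindex (regroup i)).1 (mxtens_unindex (regroup j)).1 *
    Y (mxtens_unindex (regroup i)).2 (mxtens_unindex (regroup j)).2.
  by rewrite !mxE.
have cR (r : R) : (toC r)^* = toC r.
  by apply/eqP; rewrite eq_complex /= oppr0 !eqxx.
apply/matrixP => i j; rewrite [RHS]mxE big_ord1 [(v ^t*) _ _]mxE [(v ^T) _ _]mxE.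
rewrite ![v _ _]mxE.
have sE (r : C) (X : 'M[C]_((n * n) * (n * n))) : (r *: X) i j = r * X i j.
  by rewrite mxE.
have aE (X Y : 'M[C]_((n * n) * (n * n))) : (X + Y) i j = X i j + Y i j.
  by rewrite mxE.
clearbody W; rewrite !aE !sE !aE !bE.
rewrite !WE.
have conjE (x y z t : C) : (toC al * (x * y) + toC be * (z * t))^* =
    toC al * (x^* * y^*) + toC be * (z^* * t^*).
  by rewrite rmorphD !rmorphM /= !cR.
rewrite conjE !rmorphM.
move: (mxtens_unindex (regroup i)) (mxtens_unindex (regroup j)).
move=> [i1 i2] [j1 j2] /=.
move: (k a i1) (k b i2) (k c i1) (k d i2) (toC al) (toC be) => ? ? ? ? ? ?.
move: ((k a j1)^*) ((k b j2)^*) ((k c j1)^*) ((k d j2)^*) => ? ? ? ?.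
ring.
Qed.
End LowerBounds.

(** * The dual certificate as a bilinear identity in coordinates *)

Section BilinearCertificate.
Variable R : realType.
Local Notation unit_coord := (unit_coord R).

Definition lin7 (f : nat -> R) (x : seq R) : R :=
  x`_0 * f 0%N + x`_1 * f 1%N + x`_2 * f 2%N + x`_3 * f 3%N + x`_4 * f 4%N +
  x`_5 * f 5%N + x`_6 * f 6%N.
Definition bil s x y := lin7 (fun i => lin7 (s i) y) x.

(* The partial transposes of the operators with coordinates [rank1_coord a b],
   [alt_coord], [diag12_coord] and [diag13_coord] are positive: the first two are
   rank one, on a(|11> + |22>) + b|33> and |11> - |22>, the others diagonal. *)
Definition rank1_coord (a b : R) : seq R :=
  [:: a ^+ 2; b ^+ 2; a ^+ 2; - a ^+ 2; a * b; - (a * b); 0].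
Definition alt_coord : seq R := [:: 1; 0; -1; 1; 0; 0; 0].
Definition diag12_coord : seq R := [:: 0; 0; 1; 1; 0; 0; 0].
Definition diag13_coord : seq R := [:: 0; 0; 0; 0; 1; 1; 0].
(** With u = |11> + |22> and w = |33>, the partial transposes belonging to [cross_coord] and
    [block_coord] are |u><w| + |w><u| and |u><u|. Coordinate 6 gives i(|u><w| - |w><u|); together
    they express the cross terms of superpositions over two copies. *)
Definition cross_coord : seq R := [:: 0; 0; 0; 0; 1; -1; 0].
Definition block_coord : seq R := [:: 1; 0; 1; -1; 0; 0; 0].
(** For e = 5 and e = -5 this is on the boundary of positivity, since 25 = e^2. Adding the products
    with signs (5, -5) and (-5, 5) cancels the terms odd in e and leaves -50 times [s 6 6], which
    compensates the -250 + 300 coming from the two superposition terms. *)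
Definition mixed_coord (e : R) : seq R := [:: 0; 0; 0; 0; 25; 1; e].
Definition one_coord : seq R := [:: 1; 1; 1; 1; 1; 1; 0].

(* The dual solution, [s i j] being the expectation of S on the product of the
   i-th and j-th coordinate operators: 1000 times the identity is a nonnegative
   combination of products of spectral projectors and of operators with
   nonnegative expectation; y = 387 / 500 keeps all coefficients nonnegative. *)
Lemma dual_certificate (s : nat -> nat -> R) (y : R) :
  1000 * bil s one_coord one_coord =
    720 * (s 0%N 3%N + s 3%N 0%N + s 2%N 3%N + s 3%N 2%N) + 2560 * s 3%N 3%N
  + (1400 - 1000 * y ^+ 2) * (s 0%N 4%N + s 4%N 0%N + s 2%N 4%N + s 4%N 2%N)
  + (600 - 1000 * y ^+ 2) * (s 0%N 5%N + s 5%N 0%N + s 2%N 5%N + s 5%N 2%N)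
  + (2200 + 1000 * y ^+ 2) * (s 3%N 4%N + s 4%N 3%N)
  + (1000 * y ^+ 2 - 200) * (s 3%N 5%N + s 5%N 3%N)
  + (300 + 2000 * y) * s 4%N 4%N + 400 * (s 4%N 5%N + s 5%N 4%N)
  + (1548 - 2000 * y) * s 5%N 5%N
  + (bil s (mixed_coord 5) (mixed_coord (-5)) +
     bil s (mixed_coord (-5)) (mixed_coord 5))
  + 20 * (bil s (rank1_coord 4 (-5)) alt_coord +
          bil s alt_coord (rank1_coord 4 (-5)))
  + 40 * (bil s (rank1_coord 4 (-5)) diag12_coord +
          bil s diag12_coord (rank1_coord 4 (-5)))
  + 1000 * (bil s (rank1_coord y (-1)) diag13_coord +
            bil s diag13_coord (rank1_coord y (-1)))
  + 250 * (2 * bil s block_coord (unit_coord 1) +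
           2 * bil s (unit_coord 1) block_coord -
           bil s cross_coord cross_coord - bil s (unit_coord 6) (unit_coord 6))
  + 20 * (18 * bil s block_coord block_coord +
          50 * bil s (unit_coord 1) (unit_coord 1) -
          15 * bil s cross_coord cross_coord +
          15 * bil s (unit_coord 6) (unit_coord 6)).
Proof.
rewrite /bil /lin7 /=.
ring.
Qed.

Lemma dual_bound (s : nat -> nat -> R) :
  (forall i j, (i < 6)%N -> (j < 6)%N -> 0 <= s i j) ->
  2 <= 49 * s 0%N 3%N -> 2 <= 49 * s 3%N 0%N ->
  8 <= 49 * s 0%N 4%N -> 8 <= 49 * s 4%N 0%N ->
  1 <= 49 * s 2%N 3%N -> 1 <= 49 * s 3%N 2%N -> 1 <= 49 * s 3%N 3%N ->
  4 <= 49 * s 2%N 4%N -> 4 <= 49 * s 4%N 2%N ->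
  4 <= 49 * s 3%N 4%N -> 4 <= 49 * s 4%N 3%N -> 16 <= 49 * s 4%N 4%N ->
  10000 <= 49 * bil s (mixed_coord 5) (mixed_coord (-5)) ->
  10000 <= 49 * bil s (mixed_coord (-5)) (mixed_coord 5) ->
  0 <= bil s (rank1_coord 4 (-5)) alt_coord ->
  0 <= bil s alt_coord (rank1_coord 4 (-5)) ->
  0 <= bil s (rank1_coord 4 (-5)) diag12_coord ->
  0 <= bil s diag12_coord (rank1_coord 4 (-5)) ->
  0 <= bil s (rank1_coord (387/500) (-1)) diag13_coord ->
  0 <= bil s diag13_coord (rank1_coord (387/500) (-1)) ->
  0 <= 2 * bil s block_coord (unit_coord 1) +
       2 * bil s (unit_coord 1) block_coord -
       bil s cross_coord cross_coord - bil s (unit_coord 6) (unit_coord 6) ->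
  0 <= 18 * bil s block_coord block_coord +
       50 * bil s (unit_coord 1) (unit_coord 1) -
       15 * bil s cross_coord cross_coord +
       15 * bil s (unit_coord 6) (unit_coord 6) ->
  98 + 6 / 100 <= 49 * bil s one_coord one_coord.
Proof.
move=> P h03 h30 h04 h40 h23 h32 h33 h24 h42 h34 h43 h44.
(* The resulting bound increases with y for y < 1, and this is the largest y with 1548 - 2000 y >=
   0; it lies just below the square root of 3/5, where 600 - 1000 y^2 would vanish. *)
pose y : R := 387 / 500.
have y2 : 1000 * y ^+ 2 = 599 + 76 / 1000 by rewrite /y; field.
have y1 : 2000 * y = 1548 by rewrite /y; field.
move: (P 0%N 5%N erefl erefl) (P 5%N 0%N erefl erefl).
move: (P 2%N 5%N erefl erefl) (P 5%N 2%N erefl erefl).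
move: (P 3%N 5%N erefl erefl) (P 5%N 3%N erefl erefl).
move: (P 4%N 5%N erefl erefl) (P 5%N 4%N erefl erefl).
move: h03 h30 h04 h40 h23 h32 h33 h24 h42 h34 h43 h44 => {P}.
have := dual_certificate s y; rewrite y2 y1 -/y.
move: (bil s (mixed_coord 5) _) (bil s (mixed_coord (-5)) _)
  (bil s _ alt_coord) (bil s alt_coord _).
move: (bil s _ diag12_coord) (bil s diag12_coord _)
  (bil s _ diag13_coord) (bil s diag13_coord _).
set t1 := _ - bil s (unit_coord 6) (unit_coord 6).
set t2 := _ + 15 * bil s (unit_coord 6) (unit_coord 6).
move: t1 t2 (bil s one_coord one_coord) => t1 t2 tot.
move: (s 0%N 3%N) (s 3%N 0%N) (s 2%N 3%N) (s 3%N 2%N) (s 3%N 3%N) (s 0%N 4%N)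
  (s 4%N 0%N) (s 2%N 4%N) (s 4%N 2%N) (s 0%N 5%N) (s 5%N 0%N) (s 2%N 5%N)
  (s 5%N 2%N) (s 3%N 4%N) (s 4%N 3%N) (s 3%N 5%N) (s 5%N 3%N) (s 4%N 4%N)
  (s 4%N 5%N) (s 5%N 4%N) (s 5%N 5%N).
clear; move=> *.
lra.
Qed.
End BilinearCertificate.

(** * Evaluating the dual constraints on feasible points *)

Section Pairing.
Variable R : realType.
Local Notation C := (complex R).
Local Notation toC := (real_complex R).
Local Notation unit_coord := (unit_coord R).
Local Notation alt_coord := (alt_coord R).
Local Notation diag12_coord := (diag12_coord R).
Local Notation diag13_coord := (diag13_coord R).
Local Notation block_coord := (block_coord R).
Local Notation cross_coord := (cross_coord R).

Lemma Re_toCM (r : R) (z : C) : complex.Re (toC r * z) = r * complex.Re z.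
Proof. by case: z => x y /=; rewrite mul0r subr0. Qed.

Definition step3 (s t : R) : 'cV[C]_3 := \col_x toC (if (x < 2)%N then s else t).
Definition alt3 : 'cV[C]_3 := \col_x toC (nth 0 [:: 1; -1; 0] x).

Ltac by_entries :=
  apply/matrixP; case=> [[|[|[|//]]] ?]; case=> [[|[|[|//]]] ?];
  rewrite !mxE ?big_ord1 ?mxE /=; apply/eqP; rewrite eq_complex /=;
  apply/andP; split; apply/eqP; by field.

Lemma kmx3_rank1 s t : kmx3 (rank1_coord s t) = step3 s t *m (step3 s t) ^t*.
Proof. by_entries. Qed.

Lemma kmx3_alt : kmx3 alt_coord = alt3 *m alt3 ^t*.
Proof. by_entries. Qed.

Lemma kmx3_diag12 : kmx3 diag12_coord = 0.
Proof. by_entries. Qed.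

Lemma kmx3_diag13 : kmx3 diag13_coord = 0.
Proof. by_entries. Qed.

Lemma psdmx_ptrans_rank1 s t :
  psdmx (ptrans (op3 (rank1_coord s t)) : 'M[C]_(3 * 3)).
Proof. by apply: psdmx_ptrans_op3 (kmx3_rank1 s t); rewrite /= ?addNr ?subrr. Qed.

Lemma psdmx_ptrans_alt : psdmx (ptrans (op3 alt_coord) : 'M[C]_(3 * 3)).
Proof. by apply: psdmx_ptrans_op3 kmx3_alt; rewrite /= ?addNr ?addr0. Qed.

Lemma psdmx_ptrans_diag12 : psdmx (ptrans (op3 diag12_coord) : 'M[C]_(3 * 3)).
Proof.
apply: (@psdmx_ptrans_op3 _ _ 0); rewrite ?kmx3_diag12 ?mul0mx //=; lra.
Qed.

Lemma psdmx_ptrans_diag13 : psdmx (ptrans (op3 diag13_coord) : 'M[C]_(3 * 3)).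
Proof.
apply: (@psdmx_ptrans_op3 _ _ 0); rewrite ?kmx3_diag13 ?mul0mx //=; lra.
Qed.

Lemma op3_rank1 s t : op3 (rank1_coord s t) = ldui 0 (step3 s t *m (step3 s t) ^t*).
Proof. by rewrite /op3 kmx3_rank1; congr ldui; by_entries. Qed.

Lemma op3_block : op3 block_coord = ldui 0 (step3 1 0 *m (step3 1 0) ^t*).
Proof.
by rewrite -op3_rank1 /rank1_coord /block_coord !expr1n expr0n mul1r oppr0.
Qed.

Lemma op3_33 : op3 (unit_coord 1) = ldui 0 (step3 0 1 *m (step3 0 1) ^t*).
Proof. by rewrite /op3; congr ldui; by_entries. Qed.

Lemma op3_cross : op3 cross_coord = ldui 0 (step3 1 0 *m (step3 0 1) ^t*) +
                        ldui 0 (step3 0 1 *m (step3 1 0) ^t*).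
Proof. by rewrite lduiD addr0 /op3; congr ldui; by_entries. Qed.

Lemma op3_imag : op3 (unit_coord 6) =
  Complex 0 1 *: (ldui 0 (step3 1 0 *m (step3 0 1) ^t*) +
                  -1 *: ldui 0 (step3 0 1 *m (step3 1 0) ^t*)).
Proof.
by rewrite lduiZ lduiD lduiZ !scaler0 addr0 scaler0 /op3; congr ldui; by_entries.
Qed.

Lemma op3_one : op3 (one_coord R) = 1%:M.
Proof.
have dE x y : dmx3 (one_coord R) x y = (x != y)%:R.
  rewrite mxE; case: (x == y); first exact: rmorph0.
  by case: ifP => _; rewrite /= -[1 + 1]/(2%:R) divff ?pnatr_eq0 // rmorph1.
have kE x y : kmx3 (one_coord R) x y = (x == y)%:R.
  rewrite mxE; case: (x == y); first by case: ifP => _; exact: rmorph1.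
  case: ifP => _; rewrite /= subrr mul0r ?rmorph0 //.
  by case: ifP => _; rewrite ?oppr0.
apply/matrixP => i j.
case: (mxtens_indexP i) => x1 x2; case: (mxtens_indexP j) => y1 y2.
rewrite lduiE dE kE !mxE (can_eq (@mxtens_indexK 3 3)) !xpair_eqE.
case: (x1 =P x2) => [<-|_]; rewrite ?mulr0 ?mulr1 ?add0r ?addr0 //.
by rewrite andbC.
Qed.

Lemma lin7_op3 (phi : 'M[C]_(3 * 3) -> R) x :
  (forall X Y, phi (X + Y) = phi X + phi Y) ->
  (forall r X, phi (toC r *: X) = r * phi X) ->
  phi (op3 x) = lin7 (fun i => phi (op3 (unit_coord i))) x.
Proof.
move=> hD hZ; have iotaE : iota 0 7 = [:: 0; 1; 2; 3; 4; 5; 6]%N by [].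
rewrite (op3_sum x) iotaE !big_cons !big_nil addr0.
by rewrite !hD !hZ /lin7 !addrA.
Qed.

(* [p] is abstract so that ring and lra treat its values as atoms. *)
Section BilinearTests.
Variable p : 'M[C]_(3 * 3) -> 'M[C]_(3 * 3) -> R.
Hypotheses (pDl : forall X X' Y, p (X + X') Y = p X Y + p X' Y)
  (pDr : forall X Y Y', p X (Y + Y') = p X Y + p X Y')
  (pZl : forall r X Y, p (toC r *: X) Y = r * p X Y)
  (pZr : forall r X Y, p X (toC r *: Y) = r * p X Y)
  (pii : forall X Y, p (Complex 0 1 *: X) (Complex 0 1 *: Y) = - p X Y).

Lemma bilinear_sum_sq A B :
  p (A + B) (A + B) = p A A + p B B + (p A B + p B A).
Proof. by rewrite pDl !pDr; ring. Qed.

Lemma bilinear_diff_sq A B :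
  p (Complex 0 1 *: (A + -1 *: B)) (Complex 0 1 *: (A + -1 *: B)) =
  p A B + p B A - (p A A + p B B).
Proof.
rewrite pii -[X in X *: _](rmorphN1 (real_complex R)).
by rewrite pDl !pDr pZl pZr pZl pZr; ring.
Qed.

(** The vector is u (x) w - w (x) u. The sum of the squares of A + B and i(A - B) isolates p A B + p
    B A. *)
Lemma antisymmetric_test X Y A B :
  0 <= 1 * 1 * p X Y + -1 * -1 * p Y X + 1 * -1 * (p A B + p B A) ->
  0 <= 2 * p X Y + 2 * p Y X - p (A + B) (A + B) -
       p (Complex 0 1 *: (A + -1 *: B)) (Complex 0 1 *: (A + -1 *: B)).
Proof. by rewrite bilinear_sum_sq bilinear_diff_sq; lra. Qed.

(** The vector is (3/5) u (x) u - w (x) w, scaled by 50. The difference of the two squares now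
    isolates p A A + p B B. *)
Lemma symmetric_test X Y A B :
  0 <= 3 / 5 * (3 / 5) * p X X + -1 * -1 * p Y Y +
       3 / 5 * -1 * (p A A + p B B) ->
  0 <= 18 * p X X + 50 * p Y Y - 15 * p (A + B) (A + B) +
       15 * p (Complex 0 1 *: (A + -1 *: B)) (Complex 0 1 *: (A + -1 *: B)).
Proof. by rewrite bilinear_sum_sq bilinear_diff_sq; lra. Qed.
End BilinearTests.

Section TwoCopies.
Variable S : 'M[C]_((3 * 3) * (3 * 3)).

Definition pairing X Y : R := complex.Re (\tr (S *m btens X Y)).

Lemma pairingDl X X' Y : pairing (X + X') Y = pairing X Y + pairing X' Y.
Proof. by rewrite /pairing btensDl mulmxDr mxtraceD raddfD. Qed.

Lemma pairingDr X Y Y' : pairing X (Y + Y') = pairing X Y + pairing X Y'.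
Proof. by rewrite /pairing btensDr mulmxDr mxtraceD raddfD. Qed.

Lemma pairingZl r X Y : pairing (toC r *: X) Y = r * pairing X Y.
Proof. by rewrite /pairing btensZl -scalemxAr mxtraceZ Re_toCM. Qed.

Lemma pairingZr r X Y : pairing X (toC r *: Y) = r * pairing X Y.
Proof. by rewrite /pairing btensZr -scalemxAr mxtraceZ Re_toCM. Qed.

Lemma pairing_ii X Y :
  pairing (Complex 0 1 *: X) (Complex 0 1 *: Y) = - pairing X Y.
Proof.
rewrite /pairing btensZl btensZr scalerA -scalemxAr mxtraceZ.
by case: (\tr _) => x y /=; ring.
Qed.

Let s i j := pairing (op3 (unit_coord i)) (op3 (unit_coord j)).

Lemma pairing_op3 x y : pairing (op3 x) (op3 y) = bil s x y.
Proof.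
rewrite (lin7_op3 (phi := fun X => pairing X (op3 y))) /bil.
- congr (_ + _ + _ + _ + _ + _ + _); congr (_ * _);
  rewrite (lin7_op3 (phi := pairing _)) // => *;
  by rewrite (pairingDr, pairingZr).
- by move=> *; rewrite pairingDl.
- by move=> *; rewrite pairingZl.
Qed.

Definition pi0_value (z : seq R) : R :=
  (2 * z`_0 + z`_1 + z`_2 - z`_3 + 4 * z`_4) / 7.

Lemma mxtrace_pi0_mul z :
  \tr (ptrans (pi0 R) *m op3 z) = toC (pi0_value z).
Proof.
rewrite ptrans_pi0E -scalemxAl mxtraceZ mxtrace_lambda0_mul.
by rewrite -(rmorph_nat (real_complex R)) -fmorphV -rmorphM mulrC.
Qed.

Lemma pairing_ge x y :
  kappa_feasible (btens (pi0 R) (pi0 R)) S ->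
  psdmx (op3 x) -> psdmx (op3 y) -> `|pi0_value x * pi0_value y| <= bil s x y.
Proof.
move=> fS px py; rewrite -pairing_op3.
apply: le_trans (kappa_pairing_ge fS (psdmx_btens px py)).
by rewrite ptrans_btens btensM mxtrace_btens !mxtrace_pi0_mul -rmorphM.
Qed.

Lemma pairing_ptrans_ge0 x y :
  kappa_feasible (btens (pi0 R) (pi0 R)) S ->
  psdmx (ptrans (op3 x)) -> psdmx (ptrans (op3 y)) -> 0 <= bil s x y.
Proof.
move=> fS px py; rewrite -pairing_op3 /pairing.
have := kappa_pairing_ptrans fS (psdmx_btens px py).
by rewrite ptrans_btens !ptransK.
Qed.

(** Needed beside [pairing] because the projector onto an entangled vector is not a product, so its
    partial transpose enters only as a sum of products. *)
Definition gpairing (Z : 'M[C]_((3 * 3) * (3 * 3))) : R :=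
  complex.Re (\tr (S *m ptrans Z)).

Lemma gpairingD Z Z' : gpairing (Z + Z') = gpairing Z + gpairing Z'.
Proof. by rewrite /gpairing ptransD mulmxDr mxtraceD raddfD. Qed.

Lemma gpairingZ r Z : gpairing (toC r *: Z) = r * gpairing Z.
Proof. by rewrite /gpairing ptransZ -scalemxAr mxtraceZ Re_toCM. Qed.

Lemma gpairing_btens k l :
  gpairing (btens (cldui 0 k) (cldui 0 l)) = pairing (ldui 0 k) (ldui 0 l).
Proof. by rewrite /gpairing ptrans_btens -!ptrans_ldui !ptransK. Qed.

Lemma gpairing_comb r1 r2 r3 Z1 Z2 Z3 Z4 :
  gpairing (toC r1 *: Z1 + toC r2 *: Z2 + toC r3 *: (Z3 + Z4)) =
  r1 * gpairing Z1 + r2 * gpairing Z2 + r3 * (gpairing Z3 + gpairing Z4).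
Proof. by rewrite !(gpairingD, gpairingZ). Qed.

Local Notation V u v := (ldui 0 (u *m v ^t*)).

Lemma pairing_superposition (a b c d : 'cV[C]_3) (al be : R) :
  kappa_feasible (btens (pi0 R) (pi0 R)) S ->
  0 <= al * al * pairing (V a a) (V b b) + be * be * pairing (V c c) (V d d) +
       al * be * (pairing (V a c) (V b d) + pairing (V c a) (V d b)).
Proof.
move=> fS; rewrite -!gpairing_btens -gpairing_comb.
exact: kappa_pairing_ptrans fS (psdmx_superposition a b c d al be).
Qed.

Lemma trace_two_copies_ge : kappa_feasible (btens (pi0 R) (pi0 R)) S ->
  98 + 6 / 100 <= 49 * complex.Re (\tr S).
Proof.
move=> fS.
have -> : complex.Re (\tr S) = bil s (one_coord R) (one_coord R).
  rewrite -pairing_op3 /pairing (_ : op3 (one_coord R) = 1%:M).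
    by rewrite btens_scalar mulr1 mulmx1.
  exact: op3_one.
have unitP i : (i < 6)%N -> psdmx (op3 (unit_coord i)).
  exact: psdmx_unit_coord.
have sE i j : s i j = bil s (unit_coord i) (unit_coord j) by rewrite -pairing_op3.
have sP i j : (i < 6)%N -> (j < 6)%N ->
    `|pi0_value (unit_coord i) * pi0_value (unit_coord j)| <= s i j.
  by move=> hi hj; rewrite sE; apply: (pairing_ge fS); exact: unitP.
(* Coordinate 3 carries the negative eigenvalue of pi_0^Gamma, so either sign may occur; S dominates
   the absolute value. *)
have sV i j (c : R) : (i < 6)%N -> (j < 6)%N ->
    49 * (pi0_value (unit_coord i) * pi0_value (unit_coord j)) = c \/
    49 * (pi0_value (unit_coord i) * pi0_value (unit_coord j)) = - c ->
    c <= 49 * s i j.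
  move=> hi hj e.
  apply: le_trans
    (_ : 49 * `|pi0_value (unit_coord i) * pi0_value (unit_coord j)| <= _).
    rewrite -[X in X * _](ger0_norm (ler0n R 49)) -normrM.
    by case: e => ->; rewrite ?normrN ler_norm.
  by rewrite ler_pM2l ?ltr0n // sP.
have mixedP (e : R) : e = 5 \/ e = -5 -> psdmx (op3 (mixed_coord e)).
  move=> he; apply: psdmx_op3; rewrite /= ?ler0n ?lexx ?ler01 //.
  by case: he => ->; lra.
have mixedV (e e' : R) : (e = 5 \/ e = -5) -> (e' = 5 \/ e' = -5) ->
    10000 <= 49 * bil s (mixed_coord e) (mixed_coord e').
  move=> he he'; have := pairing_ge fS (mixedP e he) (mixedP e' he').
  rewrite /pi0_value /= => /(le_trans (ler_norm _)); lra.
apply: dual_bound.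
- by move=> i j hi hj; apply: le_trans (sP i j hi hj).
- by apply: sV => //; right; rewrite /pi0_value /=; field.
- by apply: sV => //; right; rewrite /pi0_value /=; field.
- by apply: sV => //; left; rewrite /pi0_value /=; field.
- by apply: sV => //; left; rewrite /pi0_value /=; field.
- by apply: sV => //; right; rewrite /pi0_value /=; field.
- by apply: sV => //; right; rewrite /pi0_value /=; field.
- by apply: sV => //; left; rewrite /pi0_value /=; field.
- by apply: sV => //; left; rewrite /pi0_value /=; field.
- by apply: sV => //; left; rewrite /pi0_value /=; field.
- by apply: sV => //; right; rewrite /pi0_value /=; field.
- by apply: sV => //; right; rewrite /pi0_value /=; field.
- by apply: sV => //; left; rewrite /pi0_value /=; field.
- by apply: mixedV; [left|right].
- by apply: mixedV; [right|left].
- exact: pairing_ptrans_ge0 fS (psdmx_ptrans_rank1 _ _) psdmx_ptrans_alt.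
- exact: pairing_ptrans_ge0 fS psdmx_ptrans_alt (psdmx_ptrans_rank1 _ _).
- exact: pairing_ptrans_ge0 fS (psdmx_ptrans_rank1 _ _) psdmx_ptrans_diag12.
- exact: pairing_ptrans_ge0 fS psdmx_ptrans_diag12 (psdmx_ptrans_rank1 _ _).
- exact: pairing_ptrans_ge0 fS (psdmx_ptrans_rank1 _ _) psdmx_ptrans_diag13.
- exact: pairing_ptrans_ge0 fS psdmx_ptrans_diag13 (psdmx_ptrans_rank1 _ _).
- rewrite -!pairing_op3 op3_block op3_33 op3_cross op3_imag;
  apply: (antisymmetric_test pairingDl pairingDr pairingZl pairingZr pairing_ii).
  exact: (pairing_superposition (step3 1 0) (step3 0 1) (step3 0 1) (step3 1 0)
    1 (-1) fS).
- rewrite -!pairing_op3 op3_block op3_33 op3_cross op3_imag;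
  apply: (symmetric_test pairingDl pairingDr pairingZl pairingZr pairing_ii).
  exact: (pairing_superposition (step3 1 0) (step3 1 0) (step3 0 1) (step3 0 1)
    (3 / 5) (-1) fS).
Qed.
End TwoCopies.

(** In coordinates, 1 = [rank1_coord 1 (-1)] + 2 [unit_coord 3] + 2 [unit_coord 4]. The first term
    pairs nonnegatively with S, the others give at least 2/7 and 8/7. *)
Lemma trace_one_copy_ge (S : 'M[C]_(3 * 3)) :
  kappa_feasible (pi0 R) S -> 10 <= 7 * complex.Re (\tr S).
Proof.
move=> fS; pose phi (X : 'M[C]_(3 * 3)) := complex.Re (\tr (S *m X)).
have phiE x : phi (op3 x) = lin7 (fun i => phi (op3 (unit_coord i))) x.
  apply: lin7_op3 => [X Y|r X]; rewrite /phi.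
    by rewrite mulmxDr mxtraceD raddfD.
  by rewrite -scalemxAr mxtraceZ Re_toCM.
have ge x : psdmx (op3 x) -> `|pi0_value x| <= phi (op3 x).
  by move=> px; have := kappa_pairing_ge fS px; rewrite mxtrace_pi0_mul.
have h3 : `|pi0_value (unit_coord 3)| <= phi (op3 (unit_coord 3)).
  by apply: ge; exact: psdmx_unit_coord.
have h4 : `|pi0_value (unit_coord 4)| <= phi (op3 (unit_coord 4)).
  by apply: ge; exact: psdmx_unit_coord.
have hU : 0 <= phi (op3 (rank1_coord 1 (-1))).
  have := kappa_pairing_ptrans fS (psdmx_ptrans_rank1 1 (-1)).
  by rewrite ptransK.
have -> : complex.Re (\tr S) = phi (op3 (one_coord R)).
  by rewrite /phi op3_one mulmx1.
move: h3 h4 hU; rewrite !phiE /lin7 /pi0_value /=.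
move: (phi _) (phi _) (phi _) (phi _) (phi _) (phi _) (phi _).
move=> s0 s1 s2 s3 s4 s5 s6.
rewrite !ler_norml => /andP[h3 _] /andP[_ h4] hU.
lra.
Qed.
End Pairing.

(** * Feasible points and numerical values *)

Section FeasiblePoints.
Variable R : realType.
Local Notation C := (complex R).
Local Notation toC := (real_complex R).
Local Notation unit_coord := (unit_coord R).
Local Notation alt_coord := (alt_coord R).
Local Notation diag12_coord := (diag12_coord R).
Local Notation diag13_coord := (diag13_coord R).
Local Notation lambda0 := (lambda0 R).

Definition trace3 (z : seq R) : R :=
  2 * z`_0 + z`_1 + z`_2 + z`_3 + 2 * z`_4 + 2 * z`_5.

Lemma mxtrace_op3 z : \tr (op3 z) = toC (trace3 z).
Proof.
rewrite /mxtrace /trace3 sum_pairs (eq_bigr (fun p : 'I_3 * 'I_3 =>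
   dmx3 z p.1 p.2 + (p.1 == p.2)%:R * kmx3 z p.1 p.2)); last first.
  move=> [x y] _; rewrite lduiE eqxx mul1r xpair_eqE [y == x]eq_sym andbb.
  by [].
rewrite -(pair_big xpredT xpredT (fun x y =>
  dmx3 z x y + (x == y)%:R * kmx3 z x y)) /=.
rewrite !big_ord_recl !big_ord0 !mxE /= ?mulr0 ?mul0r ?mul1r ?mulr1 ?addr0.
by apply/eqP; rewrite eq_complex /=; apply/andP; split; apply/eqP; field.
Qed.

Lemma op3_sum6 z : z`_6 = 0 ->
  op3 z = \sum_(i <- iota 0 6) toC z`_i *: op3 (unit_coord i).
Proof.
move=> z6; rewrite op3_sum (_ : iota 0 7 = rcons (iota 0 6) 6%N) //.
by rewrite big_rcons_op z6 rmorph0 scale0r addr0.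
Qed.

Notation term := (R * (seq R * seq R))%type.

Definition tsum (T : seq term) : 'M[C]_((3 * 3) * (3 * 3)) :=
  \sum_(t <- T) toC t.1 *: btens (op3 t.2.1) (op3 t.2.2).

Fixpoint coef (T : seq term) i j : R :=
  if T is t :: T' then t.1 * (t.2.1`_i * t.2.2`_j) + coef T' i j else 0.

Fixpoint real_terms (T : seq term) : Prop :=
  if T is t :: T' then
    [/\ t.2.1`_6 = 0, t.2.2`_6 = 0 & real_terms T'] else True.

Fixpoint separable_terms (T : seq term) : Prop :=
  if T is t :: T' then
    [/\ 0 <= t.1, psdmx (ptrans (op3 t.2.1)), psdmx (ptrans (op3 t.2.2))
      & separable_terms T'] else True.

Fixpoint trace_terms (T : seq term) : R :=
  if T is t :: T' then t.1 * (trace3 t.2.1 * trace3 t.2.2) + trace_terms T' else 0.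

Lemma tsum_cons t T :
  tsum (t :: T) = toC t.1 *: btens (op3 t.2.1) (op3 t.2.2) + tsum T.
Proof. by rewrite /tsum big_cons. Qed.

Lemma mxtrace_tsum T : \tr (tsum T) = toC (trace_terms T).
Proof.
elim: T => [|t T IH]; first by rewrite /tsum big_nil mxtrace0 rmorph0.
rewrite tsum_cons mxtraceD IH mxtraceZ mxtrace_btens !mxtrace_op3.
by rewrite -!rmorphM -rmorphD.
Qed.

Lemma psdmx_ptrans_tsum T : separable_terms T -> psdmx (ptrans (tsum T)).
Proof.
elim: T => [_|t T IH [h1 h2 h3 /IH h4]].
  rewrite /tsum big_nil (_ : ptrans 0 = 0); first exact: psdmx0.
  by apply/matrixP => i j; rewrite !mxE.
rewrite tsum_cons ptransD ptransZ ptrans_btens.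
have h0 : 0 <= toC t.1 by rewrite -(rmorph0 (real_complex R)) lecR.
exact: psdmxD (psdmxZ h0 (psdmx_btens h2 h3)) h4.
Qed.

Lemma tsum_coef T : real_terms T -> tsum T =
  \sum_(i <- iota 0 6) \sum_(j <- iota 0 6)
    toC (coef T i j) *: btens (op3 (unit_coord i)) (op3 (unit_coord j)).
Proof.
elim: T => [_|t T IH [h1 h2 /IH hT]].
  rewrite /tsum big_nil big1 // => i _; rewrite big1 // => j _.
  by rewrite rmorph0 scale0r.
rewrite tsum_cons hT {1}(op3_sum6 h1) {1}(op3_sum6 h2).
rewrite btens_suml scaler_sumr -big_split; apply: eq_bigr => i _.
rewrite btens_sumr scaler_sumr -big_split; apply: eq_bigr => j _.
have -> : toC (coef (t :: T) i j) =
    toC t.1 * toC t.2.1`_i * toC t.2.2`_j + toC (coef T i j).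
  by rewrite -!rmorphM -rmorphD /= mulrA.
by rewrite scalerDl btensZl btensZr !scalerA.
Qed.

Lemma psdmx_tsum T : real_terms T ->
  (forall i j, (i < 6)%N -> (j < 6)%N -> 0 <= coef T i j) -> psdmx (tsum T).
Proof.
move=> rT hT; rewrite (tsum_coef rT) big_seq; apply: psdmx_sum => i.
rewrite mem_iota add0n => /andP[_ hi]; rewrite big_seq; apply: psdmx_sum => j.
rewrite mem_iota add0n => /andP[_ hj].
apply: psdmxZ; first by rewrite -(rmorph0 (real_complex R)) lecR; exact: hT.
by apply: psdmx_btens; exact: psdmx_unit_coord.
Qed.

Lemma ptrans_pi0_sq k : toC k *: ptrans (btens (pi0 R) (pi0 R)) =
  toC (k / 49) *: btens (op3 lambda0) (op3 lambda0).
Proof.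
rewrite ptrans_btens ptrans_pi0E btensZl btensZr !scalerA; congr (_ *: _).
rewrite -(rmorph_nat (real_complex R)) -fmorphV -!rmorphM; congr (toC _).
by field.
Qed.

(** Without imaginary coordinates, S and the partial transpose of pi_0 (x) pi_0 are both diagonal in
    the products of spectral projectors, so the two operator inequalities become 36 scalar ones.
    Positivity of S^Gamma is read off the terms. *)
Lemma kappa_feasible_tsum T : real_terms T -> separable_terms T ->
  (forall i j, (i < 6)%N -> (j < 6)%N ->
     `|lambda0`_i * lambda0`_j| <= 49 * coef T i j) ->
  kappa_feasible (btens (pi0 R) (pi0 R)) (tsum T).
Proof.
move=> rT sT hT.
have key k : k = 1 \/ k = -1 ->
    psdmx (tsum T + toC k *: ptrans (btens (pi0 R) (pi0 R))).
  move=> hk; rewrite ptrans_pi0_sq addrC.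
  rewrite -(tsum_cons (k / 49, (lambda0, lambda0))); apply: psdmx_tsum => //=.
  move=> i j hi hj; have := hT i j hi hj; rewrite ler_norml => /andP[h1 h2].
  by case: hk => ->; lra.
apply/kappa_feasibleE; split; last exact: psdmx_ptrans_tsum.
  by have := key 1 (or_introl erefl); rewrite rmorph1 scale1r.
by have := key (-1) (or_intror erefl); rewrite rmorphN1 scaleN1r.
Qed.

(* A rational point near the optimum of the semidefinite program, parametrised
   by the weights of a decomposition of its partial transpose into products. *)
Definition terms2 : seq term :=
  [:: (71 / 144 / 1000, (rank1_coord 5 8, rank1_coord 5 8));
      (19 / 144 / 1000, (rank1_coord 5 (-8), rank1_coord 5 (-8)));
      (5 / 36 / 36, (rank1_coord 9 14, alt_coord));
      (5 / 36 / 36, (alt_coord, rank1_coord 9 14));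
      (1 / 37 / 64, (rank1_coord 37 56, diag12_coord));
      (1 / 37 / 64, (diag12_coord, rank1_coord 37 56));
      (1 / 36 / 23, (rank1_coord 23 36, diag13_coord));
      (1 / 36 / 23, (diag13_coord, rank1_coord 23 36));
      (5 / 16, (alt_coord, alt_coord));
      (1 / 2, (alt_coord, diag12_coord));
      (1 / 2, (diag12_coord, alt_coord));
      (37 / 72, (alt_coord, diag13_coord));
      (37 / 72, (diag13_coord, alt_coord));
      (9 / 8, (diag12_coord, diag13_coord));
      (9 / 8, (diag13_coord, diag12_coord));
      (69 / 64, (diag12_coord, diag12_coord));
      (1, (diag13_coord, diag13_coord))].

Definition scaled_terms2 : seq term := [seq (t.1 / 49, t.2) | t <- terms2].

Lemma coef_scale T i j :
  49 * coef [seq (t.1 / 49, t.2) | t <- T] i j = coef T i j.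
Proof.
elim: T => [|t T IH] /=; first by rewrite mulr0.
by rewrite mulrDr IH; congr (_ + _); field.
Qed.

Lemma trace_scale T :
  49 * trace_terms [seq (t.1 / 49, t.2) | t <- T] = trace_terms T.
Proof.
elim: T => [|t T IH] /=; first by rewrite mulr0.
by rewrite mulrDr IH; congr (_ + _); field.
Qed.

Lemma trace_terms2 : trace_terms terms2 <= 98 + 1 / 10.
Proof.
rewrite /terms2 /trace_terms /trace3 /=.
lra.
Qed.

Lemma coef_terms2 i j : (i < 6)%N -> (j < 6)%N ->
  `|lambda0`_i * lambda0`_j| <= coef terms2 i j.
Proof.
case: i => [|[|[|[|[|[|//]]]]]] _; case: j => [|[|[|[|[|[|//]]]]]] _.
all: rewrite ler_norml; apply/andP; split.
all: rewrite /terms2 /=; lra.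
Qed.

Lemma real_terms2 : real_terms scaled_terms2.
Proof. by []. Qed.

Lemma separable_terms2 : separable_terms scaled_terms2.
Proof.
have hU := @psdmx_ptrans_rank1 R.
have h1 := psdmx_ptrans_alt R; have h2 := psdmx_ptrans_diag12 R.
have h3 := psdmx_ptrans_diag13 R.
rewrite /scaled_terms2 /terms2 /=.
split; [lra|exact: (hU _ _)|exact: (hU _ _)|].
split; [lra|exact: (hU _ _)|exact: (hU _ _)|].
split; [lra|exact: (hU _ _)|exact: (h1)|].
split; [lra|exact: (h1)|exact: (hU _ _)|].
split; [lra|exact: (hU _ _)|exact: (h2)|].
split; [lra|exact: (h2)|exact: (hU _ _)|].
split; [lra|exact: (hU _ _)|exact: (h3)|].
split; [lra|exact: (h3)|exact: (hU _ _)|].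
split; [lra|exact: (h1)|exact: (h1)|].
split; [lra|exact: (h1)|exact: (h2)|].
split; [lra|exact: (h2)|exact: (h1)|].
split; [lra|exact: (h1)|exact: (h3)|].
split; [lra|exact: (h3)|exact: (h1)|].
split; [lra|exact: (h2)|exact: (h3)|].
split; [lra|exact: (h3)|exact: (h2)|].
split; [lra|exact: (h2)|exact: (h2)|].
split; [lra|exact: (h3)|exact: (h3)|].
exact: Logic.I.
Qed.

Lemma kappa_feasible_terms2 :
  kappa_feasible (btens (pi0 R) (pi0 R)) (tsum scaled_terms2).
Proof.
apply: kappa_feasible_tsum real_terms2 separable_terms2 _ => i j hi hj.
by rewrite coef_scale; exact: coef_terms2.
Qed.

Lemma trace_scaled_terms2 :
  49 * complex.Re (\tr (tsum scaled_terms2)) <= 98 + 1 / 10.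
Proof. by rewrite mxtrace_tsum trace_scale; exact: trace_terms2. Qed.

(** |pi_0^Gamma| with the weight of |33> raised from 1/7 to 2/7: 2 is the least last diagonal entry
    that makes Q positive. *)
Definition opt_coord : seq R := [:: 1 / 7; 2 / 7; 1 / 7; 1 / 7; 2 / 7; 0; 0].

Lemma op3D (a b c d e f g a' b' c' d' e' f' g' : R) :
  op3 [:: a; b; c; d; e; f; g] + op3 [:: a'; b'; c'; d'; e'; f'; g'] =
  op3 [:: a + a'; b + b'; c + c'; d + d'; e + e'; f + f'; g + g'].
Proof.
rewrite lduiD; congr ldui; apply/matrixP => x y; rewrite !mxE.
  rewrite -rmorphD; congr (toC _).
  by case: (x == y); case: ((x < 2)%N && (y < 2)%N); rewrite /=; field.
case: (x == y); [|case: ((x < 2)%N && (y < 2)%N)].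
- by case: (x < 2)%N; rewrite -rmorphD; congr (toC _).
- by rewrite -rmorphD; congr (toC _); rewrite /=; field.
by case: (x < 2)%N; apply/eqP; rewrite eq_complex /=; apply/andP; split;
  apply/eqP; field.
Qed.

Lemma op3Z k (a b c d e f g : R) : toC k *: op3 [:: a; b; c; d; e; f; g] =
  op3 [:: k * a; k * b; k * c; k * d; k * e; k * f; k * g].
Proof.
rewrite lduiZ; congr ldui; apply/matrixP => x y; rewrite !mxE.
  rewrite -rmorphM; congr (toC _).
  by case: (x == y); case: ((x < 2)%N && (y < 2)%N); rewrite /=; field.
case: (x == y); [|case: ((x < 2)%N && (y < 2)%N)].
- by case: (x < 2)%N; rewrite -rmorphM; congr (toC _).
- by rewrite -rmorphM; congr (toC _); rewrite /=; field.
by case: (x < 2)%N; apply/eqP; rewrite eq_complex /=; apply/andP; split;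
  apply/eqP; field.
Qed.

Lemma kappa_feasible_opt_coord : kappa_feasible (pi0 R) (op3 opt_coord).
Proof.
have p17 k : toC k *: ptrans (pi0 R) = toC (k / 7) *: op3 lambda0.
  rewrite ptrans_pi0E scalerA; congr (_ *: _).
  by rewrite -(rmorph_nat (real_complex R)) -fmorphV -rmorphM.
have key k : k = 1 \/ k = -1 -> psdmx (op3 opt_coord + toC k *: ptrans (pi0 R)).
  move=> hk; rewrite p17 /lambda0 op3Z op3D; apply: psdmx_op3; rewrite /=;
  by case: hk => ->; lra.
apply/kappa_feasibleE; split.
- by have := key 1 (or_introl erefl); rewrite rmorph1 scale1r.
- by have := key (-1) (or_intror erefl); rewrite rmorphN1 scaleN1r.
have -> : op3 opt_coord = toC (1 / 14) *: op3 (rank1_coord 1 2) +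
    toC (1 / 14) *: op3 alt_coord +
    toC (1 / 7) *: op3 diag12_coord + toC (1 / 7) *: op3 diag13_coord.
  rewrite !op3Z !op3D; congr op3.
  by repeat (congr cons; first by field).
have pos (k : R) : 0 <= k -> 0 <= toC k.
  by move=> k0; rewrite -(rmorph0 (real_complex R)) lecR.
have h14 : 0 <= toC (1 / 14) by apply: pos; lra.
have h7 : 0 <= toC (1 / 7) by apply: pos; lra.
rewrite !ptransD !ptransZ.
exact: psdmxD (psdmxD (psdmxD (psdmxZ h14 (psdmx_ptrans_rank1 1 2))
  (psdmxZ h14 (psdmx_ptrans_alt R))) (psdmxZ h7 (psdmx_ptrans_diag12 R)))
  (psdmxZ h7 (psdmx_ptrans_diag13 R)).
Qed.

Lemma trace_opt_coord : complex.Re (\tr (op3 opt_coord)) = 10 / 7.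
Proof. by rewrite mxtrace_op3 /trace3 /=; field. Qed.
End FeasiblePoints.

Section Logarithms.
Variable R : realType.
Implicit Types x : R.

Lemma ln2_gt0 : 0 < ln (2 : R).
Proof. by apply: ln_gt0; rewrite ltr1n. Qed.

Lemma log2_lt_ratio x p q : 0 < x -> (0 < q)%N -> x ^+ q < 2 ^+ p ->
  log2 x < p%:R / q%:R.
Proof.
move=> x0 q0 h; rewrite /log2 ltr_pdivrMr ?ln2_gt0 // mulrAC ltr_pdivlMr ?ltr0n //.
rewrite mulr_natr mulr_natl -!lnXn ?ltr0n //.
by rewrite ltr_ln // posrE exprn_gt0 // ltr0n.
Qed.

Lemma log2_gt_ratio x p q : 0 < x -> (0 < q)%N -> 2 ^+ p < x ^+ q ->
  p%:R / q%:R < log2 x.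
Proof.
move=> x0 q0 h; rewrite /log2 ltr_pdivlMr ?ln2_gt0 // mulrAC ltr_pdivrMr ?ltr0n //.
rewrite mulr_natr mulr_natl -!lnXn ?ltr0n //.
by rewrite ltr_ln // posrE exprn_gt0 // ltr0n.
Qed.

Lemma log2_double x : 0 < x -> log2 (2 * x) = 1 + log2 x.
Proof.
by move=> x0; rewrite /log2 lnM ?posrE ?ltr0n // mulrDl divff // gt_eqF ?ln2_gt0.
Qed.

Lemma log2_10_7 :
  1029 / 1000 - 1 / 2000 < 2 * log2 (10 / 7 : R) < 1029 / 1000 + 1 / 2000.
Proof.
have x0 : 0 < 10 / 7 :> R by lra.
(* The fractions 18/35 and 35/68 enclose log2 (10/7), and their doubles lie within 1/2000 of
   1.029. *)
have h1 : 2 ^+ 18 < (10 / 7) ^+ 35 :> R by lra.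
have h2 : (10 / 7) ^+ 68 < 2 ^+ 35 :> R by lra.
have := log2_gt_ratio x0 (isT : (0 < 35)%N) h1.
have := log2_lt_ratio x0 (isT : (0 < 68)%N) h2.
by move=> k1 k2; apply/andP; split; lra.
Qed.

Lemma log2_two_copies (t : R) : 98 + 6 / 100 <= 49 * t -> 49 * t <= 98 + 1 / 10 ->
  1001 / 1000 - 1 / 2000 < log2 t < 1001 / 1000 + 1 / 2000.
Proof.
move=> t1 t2; pose u := t / 2.
have u1 : 9806 / 9800 <= u by rewrite /u; move: t1; clear; lra.
have u2 : u <= 981 / 980 by rewrite /u; move: t2; clear; lra.
have u0 : 0 < u by apply: lt_le_trans u1; clear; lra.
have -> : log2 t = 1 + log2 u.
  by rewrite -log2_double // /u; congr log2; clear; field.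
have pow_mono (x y : R) n : 0 <= x -> x <= y -> x ^+ n <= y ^+ n.
  by move=> x0 xy; apply: lerXn2r => //; rewrite nnegrE // (le_trans x0).
(* It suffices that 1/1600 < log2 u < 1/667, and 667 is the least integer with 1/667 < 0.0015.
   Factoring the exponents as 23 * 29 and 40 * 40, with rounding to a simple fraction in between,
   keeps the numbers small. *)
have h1 : u ^+ (23 * 29) < 2 ^+ 1.
  have a1 : (981 / 980) ^+ 23 <= 128 / 125 :> R by clear; lra.
  have a2 : (128 / 125) ^+ 29 < 2 :> R by clear; lra.
  have u23 : 0 <= u ^+ 23 by rewrite exprn_ge0 // ltW.
  rewrite exprM expr1.
  have u23_le := le_trans (pow_mono _ _ 23%N (ltW u0) u2) a1.
  exact: le_lt_trans (pow_mono _ _ 29%N u23 u23_le) a2.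
have h2 : 2 ^+ 1 < u ^+ (40 * 40).
  have b1 : 102 / 100 <= (9806 / 9800) ^+ 40 :> R by clear; lra.
  have b2 : 2 < (102 / 100) ^+ 40 :> R by clear; lra.
  have p1 : 0 <= 9806 / 9800 :> R by clear; lra.
  have p2 : 0 <= 102 / 100 :> R by clear; lra.
  rewrite exprM expr1; apply: lt_le_trans b2 _.
  exact: (pow_mono _ _ 40%N p2 (le_trans b1 (pow_mono _ _ 40%N p1 u1))).
have := log2_lt_ratio u0 (isT : (0 < 23 * 29)%N) h1.
have := log2_gt_ratio u0 (isT : (0 < 40 * 40)%N) h2.
move: (log2 u) => l; rewrite !natrM; clear=> k1 k2.
by apply/andP; split; lra.
Qed.
End Logarithms.

Theorem propositionS4 (R : realType) :
  [/\ (2%:E * Ec_ppt_exact (pi0 R) <= (Ekappa (btensX (pi0 R) 2))%:E)%E,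
      Ekappa (btensX (pi0 R) 2) < 2 * Ekappa (pi0 R),
      `|Ekappa (btensX (pi0 R) 2) - 1001 / 1000| < 1 / 2000
    & `|2 * Ekappa (pi0 R) - 1029 / 1000| < 1 / 2000].
Proof.
have f1 := kappa_feasible_opt_coord R; have f2 := kappa_feasible_terms2 R.
have s1 := pi0_state R; have s2 := state_btens s1 s1.
have Esingle : Ekappa (pi0 R) = log2 (10 / 7).
  have [S [fS minS ->]] := Ekappa_minE s1.1.1; congr log2.
  apply/eqP; rewrite eq_le; apply/andP; split.
    by rewrite -trace_opt_coord; exact: minS.
  by have := trace_one_copy_ge fS; lra.
have [S [fS minS Emin]] := Ekappa_minE s2.1.1.
have t1 := trace_two_copies_ge fS.
have t2 : 49 * complex.Re (\tr S) <= 98 + 1 / 10.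
  by apply: le_trans (trace_scaled_terms2 R); rewrite ler_pM2l ?ltr0n // minS.
have /andP[a1 a2] := log2_10_7 R.
have /andP[b1 b2] := log2_two_copies t1 t2.
have Epair : Ekappa (btensX (pi0 R) 2) = log2 (complex.Re (\tr S)) by exact: Emin.
split.
- exact: Ec_ppt_exact_le s1 f1.
- by rewrite Epair Esingle; move: a1 b2; clear; lra.
- by rewrite Epair ltr_norml; move: b1 b2; clear=> b1 b2; apply/andP; split; lra.
- by rewrite Esingle ltr_norml; move: a1 a2; clear=> a1 a2; apply/andP; split; lra.
Qed.
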